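(* Let $\{X^{(i)}\}_{i=1}^m\subset\mathcal{H}_n$ be a finite sequence of independent random $n\times n$ Hermitian matrices, and let $Y=\sum_{i=1}^mX^{(i)}$. Assume that there is a constant $c\geq 0$ such that $0\leq \lambda_n(X^{(i)})\leq \lambda_1(X^{(i)})\leq c$ for each $i$. Then for any integer $1\leq k\leq n$, $$\mathbb{E}\sum_{i=1}^k\lambda_i(Y) \leq \inf_{\theta>0}\left\{ \frac{e^\theta-1}{\theta}\sum_{i=1}^k\lambda_i(\mathbb{E}Y)+\frac{c}{\theta}\ln\binom{n}{k}\right\},$$ $$\mathbb{E}\sum_{i=1}^k\lambda_{n-i+1}(Y) \geq \sup_{\theta>0}\left\{ \frac{1-e^{-\theta}}{\theta}\sum_{i=1}^k\lambda_{n-i+1}(\mathbb{E}Y)- \frac{c}{\theta}\ln\binom{n}{k}\right\},$$ and, when $c>0$, $$\mathbb{P}\left\{\sum_{i=1}^k\lambda_i(Y) \geq (1+\varepsilon)\sum_{i=1}^k\lambda_i(\mathbb{E}Y)\right\}\leq \binom{n}{k}^\frac{1}{k}\left(\frac{e^\varepsilon}{(1+\varepsilon)^{1+\varepsilon}}\right)^{\frac{1}{ck}\sum_{i=1}^k\lambda_i(\mathbb{E}Y)}\quad\text{for all }\varepsilon \geq 0,$$ $$\mathbb{P}\left\{\sum_{i=1}^k\lambda_{n-i+1}(Y) \leq (1-\varepsilon)\sum_{i=1}^k\lambda_{n-i+1}(\mathbb{E}Y)\right\}\leq \binom{n}{k}^\frac{1}{k}\left(\frac{e^{-\varepsilon}}{(1-\varepsilon)^{1-\varepsilon}}\right)^{\frac{1}{ck}\sum_{i=1}^k\lambda_{n-i+1}(\mathbb{E}Y)}\quad\text{for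 all }\varepsilon\in[0,1).$$
   Context: $\mathcal{H}_n$ is the space of $n\times n$ complex Hermitian matrices. For $A\in\mathcal{H}_n$, $\lambda_i(A)$ denotes the $i$-th largest eigenvalue of $A$ (counted with multiplicity), so $\lambda_1$ is the largest, $\lambda_n$ the smallest, and $\lambda_{n-i+1}(A)$ the $i$-th smallest. The expectation of a random matrix is taken entrywise. *)

(* Defs.v *)
From HB Require Import structures.
From mathcomp Require Import all_boot all_order all_algebra.
From mathcomp Require Import all_classical all_reals all_analysis.
From mathcomp Require Import complex.

Set Implicit Arguments.
Unset Strict Implicit.
Unset Printing Implicit Defensive.

Import Order.TTheory GRing.Theory Num.Theory.

Local Open Scope classical_set_scope.
Local Open Scope ring_scope.
Local Open Scope complex_scope.

(* Eigenvalues are the roots of the characteristic polynomial, repeated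
   according to multiplicity. *)
Definition eigenvalues (R : realType) (n : nat) (A : 'M[R[i]]_n) : seq R[i] :=
  sval (closed_field_poly_normal (char_poly A)).

(* The eigenvalues of a Hermitian matrix are real, so that [complex.Re] only
   changes their type; on other matrices this sequence has no meaning. *)
Definition real_eigenvalues (R : realType) (n : nat) (A : 'M[R[i]]_n) :
    seq R :=
  sort (fun x y : R => y <= x) [seq complex.Re z | z <- eigenvalues A].

(* Indices are 1-based: [lambda 1 A] is the largest eigenvalue and [lambda n A]
   the smallest. Only 1 <= j <= n is meaningful. *)
Definition lambda (R : realType) (n : nat) (j : nat) (A : 'M[R[i]]_n) : R :=
  nth 0 (real_eigenvalues A) j.-1.

(* The Borel sigma-algebra of the finite-dimensional real vector space of
   complex matrices, generated by the real coordinates. *)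
Definition mx_borel (R : realType) (n : nat) : set_system 'M[R[i]]_n :=
  <<s [set E | exists (a b : 'I_n) (B : set R), measurable B /\
         (E = [set A : 'M[R[i]]_n | B (complex.Re (A a b))] \/
          E = [set A : 'M[R[i]]_n | B (complex.Im (A a b))])] >>.

Definition random_matrix d (T : measurableType d) (R : realType) (n : nat)
    (X : T -> 'M[R[i]]_n) : Prop :=
  forall B, mx_borel B -> measurable (X @^-1` B).

Definition independent_matrices d (T : measurableType d) (R : realType)
    (P : probability T R) (m n : nat) (X : 'I_m -> T -> 'M[R[i]]_n) : Prop :=
  forall (J : {set 'I_m}) (B : 'I_m -> set 'M[R[i]]_n),
    (forall i, i \in J -> mx_borel (B i)) ->
    P (\bigcap_(i in [set` J]) (X i @^-1` B i)) =
    (\prod_(i in J) P (X i @^-1` B i))%E.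

(* Entrywise; [fine] is harmless when the entries are integrable. *)
Definition expected_matrix d (T : measurableType d) (R : realType)
    (P : probability T R) (n : nat) (X : T -> 'M[R[i]]_n) : 'M[R[i]]_n :=
  \matrix_(a, b)
    (fine (expectation P (fun w => complex.Re (X w a b))) +i*
     fine (expectation P (fun w => complex.Im (X w a b)))).

(* Main.v *)
(** Write U(A) for the sum of the k largest eigenvalues of A.  By Ky Fan, U is
subadditive, so U(tY) <= U(tY - g EY) + g U(EY) for g >= 0, and by convexity of
exp, k exp(U(Z) / k) <= Tr exp Z.  Hence all four bounds follow from the scalar
estimate E Tr exp(tY - g EY) <= n, with c t = theta and
c g = exp(theta) - 1, because n / k <= C(n, k)^(1/k); the two bounds on the
smallest eigenvalues come from theta < 0.

The trace estimate needs no Lieb concavity.  The summands are removed one at a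
time.  For 0 <= X <= 1 and a Hermitian B,
   Tr exp(B + theta X) <= Tr (exp B) (1 + (exp(theta) - 1) X),
the right-hand side is affine in X, so that independence replaces X by its mean,
and Klein's inequality Tr (exp B) (1 + K) <= Tr exp(B + K) absorbs the mean into
the exponent.  Both trace inequalities reduce to scalar ones: in eigenbases
u, v of A, B one has Tr f(A) g(B) = sum_ij f(a_i) g(b_j) |<u_i, v_j>|^2. *)

Require Import Defs.
From HB Require Import structures.
From mathcomp Require Import all_boot all_order all_algebra.
From mathcomp Require Import all_classical all_reals all_analysis.
From mathcomp Require Import complex.
From mathcomp Require Import measurable_realfun ring lra zify.

Set Implicit Arguments.
Unset Strict Implicit.
Unset Printing Implicit Defensive.

Import Order.TTheory GRing.Theory Num.Theory.

Local Open Scope classical_set_scope.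
Local Open Scope ring_scope.
Local Open Scope complex_scope.
Local Open Scope sesquilinear_scope.

(** * Spectral calculus *)

(** The inequality for B + theta X comes from f(t) = Tr X exp(B + t X), the derivative of Tr exp(B +
    t X). Since X^2 <= X, one has f' <= Tr X^2 exp(B + t X) <= f, so f(t) <= exp(t) f(0), and
    integrating from 0 to theta gives the factor exp(theta) - 1. Differentiating a matrix
    exponential is avoided: finite increments are compared instead, through the trapezoid inequality
    for exp, which is symmetric in its two points and expands into products of a function of A and a
    function of B. The discrete growth factor (1 + e/2) / (1 - e/2) yields the exponential as the
    step e shrinks. Centring by g EY keeps the trace estimate at Tr exp 0 = n whatever the means
    are; their eigenvalues enter only through Ky Fan. Measurability is a separate obstacle:
    eigenvalues are sorted roots of a polynomial, and the chosen eigenbasis need not vary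
    measurably. The exponential is reached through its power series, and the eigenvalues are
    recovered from the growth of Tr exp(N A) in N. *)

Section complex_parts.
Variable R : realType.
Implicit Types x y z : R[i].

Lemma cReD x y : complex.Re (x + y) = complex.Re x + complex.Re y.
Proof. by case: x y => [? ?] [? ?]. Qed.
Lemma cImD x y : complex.Im (x + y) = complex.Im x + complex.Im y.
Proof. by case: x y => [? ?] [? ?]. Qed.
Lemma cReN x : complex.Re (- x) = - complex.Re x.
Proof. by case: x. Qed.
Lemma cReM x y : complex.Re (x * y) =
  complex.Re x * complex.Re y - complex.Im x * complex.Im y.
Proof. by case: x y => [? ?] [? ?]. Qed.
Lemma cImM x y : complex.Im (x * y) =
  complex.Re x * complex.Im y + complex.Im x * complex.Re y.
Proof. by case: x y => [? ?] [? ?]. Qed.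
Lemma cRe_sum (I : Type) (r : seq I) (P : pred I) (F : I -> R[i]) :
  complex.Re (\sum_(i <- r | P i) F i) = \sum_(i <- r | P i) complex.Re (F i).
Proof. exact: (big_morph _ cReD). Qed.
Lemma cIm_sum (I : Type) (r : seq I) (P : pred I) (F : I -> R[i]) :
  complex.Im (\sum_(i <- r | P i) F i) = \sum_(i <- r | P i) complex.Im (F i).
Proof. exact: (big_morph _ cImD). Qed.
Lemma conjCE (x : R[i]) : Num.conj x = complex.Re x -i* complex.Im x.
Proof. by case: x. Qed.
End complex_parts.

(* The eigenvectors are the conjugates of the rows of U. *)
HB.lock Definition spectral_mx (R : realType) (n : nat) (U : 'M[R[i]]_n)
    (f : 'I_n -> R) : 'M[R[i]]_n :=
  U ^t* *m diag_mx (\row_i (f i)%:C) *m U.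

Section spectral_calculus.
Variables (R : realType) (n : nat).
Implicit Types (A B U V : 'M[R[i]]_n) (f g : 'I_n -> R).

Definition rtr A : R := complex.Re (\tr A).

(** Doubly stochastic for unitary U and V, so that its rows and columns serve as weights of convex
    combinations. *)
Definition overlap U V i j : R :=
  let z := (U *m V ^t*) i j in complex.Re z ^+ 2 + complex.Im z ^+ 2.

Lemma rtrD A B : rtr (A + B) = rtr A + rtr B.
Proof. by rewrite /rtr mxtraceD cReD. Qed.

Lemma rtrN A : rtr (- A) = - rtr A.
Proof. by rewrite /rtr raddfN cReN. Qed.

Lemma rtrB A B : rtr (A - B) = rtr A - rtr B.
Proof. by rewrite rtrD rtrN. Qed.

Lemma rtrZ (a : R) A : rtr (a%:C *: A) = a * rtr A.
Proof. by rewrite /rtr mxtraceZ cReM /= mul0r subr0. Qed.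

Lemma rtrC A B : rtr (A *m B) = rtr (B *m A).
Proof. by rewrite /rtr mxtrace_mulC. Qed.

Lemma spectral_mxM U f g : U \is unitarymx ->
  spectral_mx U f *m spectral_mx U g = spectral_mx U (fun i => f i * g i).
Proof.
move=> /unitarymxP; rewrite spectral_mx.unlock; move: (U ^t*) => W UW.
rewrite -!mulmxA (mulmxA U W) UW mul1mx (mulmxA (diag_mx _) (diag_mx _)).
rewrite mulmx_diag; congr (_ *m (diag_mx _ *m _)).
by apply/rowP => i; rewrite !mxE -rmorphM.
Qed.

Lemma spectral_mxE U f a b :
  spectral_mx U f a b = \sum_i Num.conj (U i a) * (f i)%:C * U i b.
Proof.
rewrite spectral_mx.unlock mxE; apply: eq_bigr => i _.
by rewrite mul_mx_diag !mxE.
Qed.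

Lemma spectral_mxD U f g :
  spectral_mx U f + spectral_mx U g = spectral_mx U (fun i => f i + g i).
Proof.
apply/matrixP => a b; rewrite mxE !spectral_mxE -big_split/=.
by apply: eq_bigr => i _; rewrite rmorphD/= mulrDr mulrDl.
Qed.

Lemma spectral_mxZ U (a : R) f :
  a%:C *: spectral_mx U f = spectral_mx U (fun i => a * f i).
Proof.
apply/matrixP => x y; rewrite mxE !spectral_mxE mulr_sumr.
by apply: eq_bigr => i _; rewrite rmorphM/= !mulrA [a%:C * _]mulrC.
Qed.

Lemma spectral_mx1 U : U \is unitarymx -> spectral_mx U (fun=> 1) = 1%:M.
Proof.
move=> uU; rewrite spectral_mx.unlock.
have -> : diag_mx (\row_i (1 : R)%:C) = 1%:M :> 'M[R[i]]_n.
  by apply/matrixP => i j; rewrite !mxE.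
by rewrite mulmx1; apply: mulmx1C; apply/unitarymxP.
Qed.

Lemma rtr_spectral U f : U \is unitarymx -> rtr (spectral_mx U f) = \sum_i f i.
Proof.
move=> uU; rewrite spectral_mx.unlock rtrC mulmxA (unitarymxP uU) mul1mx /rtr mxtrace_diag.
by rewrite cRe_sum; apply: eq_bigr => i _; rewrite mxE.
Qed.

Lemma overlap_ge0 U V i j : 0 <= overlap U V i j.
Proof. by rewrite addr_ge0// sqr_ge0. Qed.

Lemma rtr_spectral2 U V f g :
  rtr (spectral_mx U f *m spectral_mx V g) =
  \sum_i \sum_j f i * g j * overlap U V i j.
Proof.
rewrite spectral_mx.unlock -!mulmxA rtrC -!mulmxA [rtr _](_ : _ =
  rtr (diag_mx (\row_i (f i)%:C) *m ((U *m V ^t*) *m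
    (diag_mx (\row_i (g i)%:C) *m ((U *m V ^t*) ^t*))))); last first.
  by rewrite trmx_mul map_mxM trmxCK -!mulmxA.
rewrite /rtr /overlap; move: (U *m V ^t*) => O.
rewrite cRe_sum; apply: eq_bigr => i _.
rewrite mul_diag_mx mxE mxE mxE cReM /= mul0r subr0 cRe_sum mulr_sumr.
apply: eq_bigr => j _; rewrite mul_diag_mx !mxE conjCE.
by case: (O i j) => a b /=; ring.
Qed.

Lemma overlap_row U V i : U \is unitarymx -> V \is unitarymx ->
  \sum_j overlap U V i j = 1.
Proof.
rewrite /overlap => uU uV.
have : U *m V ^t* \is unitarymx by apply: (mul_unitarymx uU); rewrite trmxC_unitary.
move: (U *m V ^t*) => O uO.
have /matrixP/(_ i i) := unitarymxP uO; rewrite !mxE eqxx.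
move=> /(congr1 (@complex.Re R)); rewrite cRe_sum /= => <-.
apply: eq_bigr => j _; rewrite !mxE conjCE.
by case: (O i j) => a b /=; ring.
Qed.

Lemma overlapC U V i j : overlap U V i j = overlap V U j i.
Proof.
have -> : overlap V U j i =
    let z := ((U *m V ^t*) ^t*) j i in complex.Re z ^+ 2 + complex.Im z ^+ 2.
  by rewrite /overlap trmx_mul map_mxM trmxCK.
rewrite /overlap /= [in RHS]mxE [in RHS]mxE conjCE.
by case: (_ i j) => a b /=; rewrite sqrrN.
Qed.

Lemma overlap_col U V j : U \is unitarymx -> V \is unitarymx ->
  \sum_i overlap U V i j = 1.
Proof.
by move=> uU uV; under eq_bigr do rewrite overlapC; exact: overlap_row.
Qed.

(** Indexed like the rows of [spectralmx A], hence unsorted, unlike [lambda]; [sum_real_eigenvalues]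
    links the two for symmetric sums. *)
Definition eigval A i : R := complex.Re (spectral_diag A 0 i).

Definition funmx (f : R -> R) A := spectral_mx (spectralmx A) (f \o eigval A).

Lemma funmx_id A : A \is hermsymmx -> A = funmx id A.
Proof.
move=> hA; have /hermitian_normalmx /orthomx_spectralP := hA.
rewrite invmx_unitary ?spectral_unitarymx// => {1}->.
rewrite /funmx spectral_mx.unlock; congr (mulmx (mulmx _ _) _).
congr diag_mx; apply/rowP => i; rewrite mxE /eigval /=.
have /mxOverP/(_ 0 i) := hermitian_spectral_diag_real hA.
by case: (spectral_diag A 0 i) => a b; rewrite complex_real => /eqP/= ->.
Qed.

Lemma hermP A : reflect (A ^t* = A) (A \is hermsymmx).
Proof.
by apply: (iffP (is_hermitianmxP _ _ _)); rewrite expr0 scale1r => /esym.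
Qed.

Lemma spectral_herm U f : spectral_mx U f \is hermsymmx.
Proof.
apply/hermP/matrixP => a b; rewrite mxE mxE !spectral_mxE rmorph_sum/=.
apply: eq_bigr => i _; rewrite !conjCE.
by case: (U i a) (U i b) => [x y] [z t]/=; simpc; congr Complex; ring.
Qed.

Lemma hermD A B : A \is hermsymmx -> B \is hermsymmx -> A + B \is hermsymmx.
Proof.
move=> /hermP hA /hermP hB; apply/hermP.
by rewrite linearD/= map_mxD hA hB.
Qed.

Lemma hermZ (a : R) A : A \is hermsymmx -> a%:C *: A \is hermsymmx.
Proof.
move=> /hermP hA; apply/hermP; rewrite linearZ/= map_mxZ.
by rewrite /= hA conjCE /= oppr0.
Qed.

Lemma hermN A : A \is hermsymmx -> - A \is hermsymmx.
Proof. by move=> /(hermZ (-1)); rewrite rmorphN rmorph1 scaleN1r. Qed.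

Lemma herm0 : (0 : 'M[R[i]]_n) \is hermsymmx.
Proof. by apply/hermP; rewrite trmx0 map_mx0. Qed.

Lemma herm_sum (I : Type) (r : seq I) (P : pred I) (F : I -> 'M[R[i]]_n) :
  (forall i, P i -> F i \is hermsymmx) ->
  \sum_(i <- r | P i) F i \is hermsymmx.
Proof.
by move=> h; elim/big_rec: _ => [|i A Pi hA]; [exact: herm0|exact/hermD/hA/h].
Qed.

End spectral_calculus.

(** * Trace inequalities *)

Section exp_inequalities.
Variable R : realType.
Implicit Types x y d : R.

(** Convexity of exp as a tangent line; it yields both [klein] and the Jensen step in
    [expR_top_sum]. *)
Lemma expR_tangent x y : expR y + expR y * (x - y) <= expR x.
Proof.
have -> : expR x = expR y * expR (x - y) by rewrite -expRD addrC subrK.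
have := ler_wpM2l (expR_ge0 y) (expR_ge1Dx (x - y)); lra.
Qed.

(* Equivalently tanh (d / 2) <= d / 2. *)
Lemma expR_trapezoid0 d : 0 <= d -> expR d - 1 <= d * (expR d + 1) / 2.
Proof.
move=> d0.
pose f (x : R) := x * (expR x + 1) / 2 - expR x.
pose df (x : R) := (x * expR x - expR x + 1) / 2.
have fd x : is_derive x 1 f (df x).
  apply: is_derive_eq.
  rewrite /df /= !scaler0 !scaler1 /GRing.scale/=.
  by field.
have fc : {within `[0, d], continuous f}.
  apply: derivable_within_continuous => x _; exact: (@ex_derive _ _ _ _ _ _ _ (fd x)).
have [c /andP[c0 _] fE] := MVT_segment d0 (fun x _ => fd x) fc.
have : 0 <= f d - f 0.
  rewrite fE mulr_ge0 ?subr0// /df divr_ge0//.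
  (* Multiplied by exp(-c), the sign of the derivative becomes c - 1 + exp(-c) >= 0. *)
  rewrite -(pmulr_rge0 _ (expR_gt0 (- c))) mulrDr mulrBr mulr1 mulrCA -expRD.
  rewrite addNr expR0 mulr1; have := expR_ge1Dx (- c); lra.
rewrite /f expR0; lra.
Qed.

(** The integral of the convex function exp lies below its trapezoid. The extra factor x - y makes
    the inequality independent of the order of x and y, as is needed for pairs of eigenvalues of two
    matrices. *)
Lemma expR_trapezoid x y :
  (x - y) * (expR x - expR y) <= (x - y) ^+ 2 * (expR x + expR y) / 2.
Proof.
wlog xy : x y / y <= x.
  move=> H; have [/H//|/ltW/H] := leP y x.
  by rewrite -[y - x]opprB -[expR y - _]opprB mulrNN sqrrN [expR y + _]addrC.
have h : expR x - expR y <= (x - y) * (expR x + expR y) / 2.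
  have -> : expR x = expR y * expR (x - y) by rewrite -expRD addrC subrK.
  have d0 : 0 <= x - y by rewrite subr_ge0.
  have := ler_wpM2l (expR_ge0 y) (expR_trapezoid0 d0); lra.
have := ler_wpM2l (_ : 0 <= x - y) h; rewrite subr_ge0 => /(_ xy); lra.
Qed.

End exp_inequalities.

Section trace_inequalities.
Variables (R : realType) (n : nat).
Implicit Types (A B X : 'M[R[i]]_n) (f g : R -> R).

Definition expmx A : 'M[R[i]]_n := funmx expR A.

Lemma funmxM f g A : funmx f A *m funmx g A = funmx (f \* g) A.
Proof. by rewrite spectral_mxM// spectral_unitarymx. Qed.

Lemma funmx1 A : funmx (cst 1) A = 1%:M.
Proof. by rewrite -(spectral_mx1 (spectral_unitarymx A)). Qed.

(* Lifts a scalar inequality in two variables to traces of two matrices that need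
   not commute. *)
Lemma rtr_funmx2_ge0 A B (s : seq (R * ((R -> R) * (R -> R)))) :
  (forall x y, 0 <= \sum_(p <- s) p.1 * (p.2.1 x * p.2.2 y)) ->
  0 <= \sum_(p <- s) p.1 * rtr (funmx p.2.1 A *m funmx p.2.2 B).
Proof.
move=> h; rewrite [leRHS](_ : _ = \sum_i \sum_j
    overlap (spectralmx A) (spectralmx B) i j *
    \sum_(p <- s) p.1 * (p.2.1 (eigval A i) * p.2.2 (eigval B j))).
  by apply: sumr_ge0 => i _; apply: sumr_ge0 => j _; rewrite mulr_ge0 ?overlap_ge0.
under [RHS]eq_bigr do under eq_bigr do rewrite mulr_sumr.
under [RHS]eq_bigr do rewrite exchange_big.
rewrite exchange_big; apply: eq_bigr => p _ /=.
rewrite rtr_spectral2 mulr_sumr; apply: eq_bigr => i _.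
by rewrite mulr_sumr; apply: eq_bigr => j _ /=; ring.
Qed.

Lemma klein A B : A \is hermsymmx -> B \is hermsymmx ->
  rtr (expmx B) + rtr ((A - B) *m expmx B) <= rtr (expmx A).
Proof.
move=> hA hB; rewrite -subr_ge0.
(* The four terms of exp x - exp y - (x - y) exp y, each a function of x times a function of y. *)
have := @rtr_funmx2_ge0 A B [:: (1, (expR, cst 1)); (-1, (cst 1, expR));
  (-1, (id, expR)); (1, (cst 1, id \* expR))].
rewrite !big_cons !big_nil/= !funmx1 mulmx1 !mul1mx -funmxM -!funmx_id// => h.
rewrite mulmxBl rtrB /expmx.
have {}h := h _; suff : 0 <= 1 * rtr (funmx expR A) + (-1 * rtr (funmx expR B) +
  (-1 * rtr (A *m funmx expR B) + (1 * rtr (B *m funmx expR B) + 0))) by lra.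
apply: h => x y; rewrite !big_cons !big_nil/=.
have := expR_tangent x y; lra.
Qed.

Lemma expmxC A : A \is hermsymmx -> A *m expmx A = expmx A *m A.
Proof.
move=> hA; rewrite [X in X *m _](funmx_id hA) [X in _ = _ *m X](funmx_id hA).
by rewrite !funmxM; congr funmx; apply/funext => x /=; rewrite mulrC.
Qed.

(** With A - B = e X this bounds the increment of Tr X exp over one step by its values at the two
    ends, in place of a derivative. *)
Lemma rtr_expmx_trapezoid A B : A \is hermsymmx -> B \is hermsymmx ->
  rtr ((A - B) *m (expmx A - expmx B)) <=
  rtr ((A - B) *m (A - B) *m (expmx A + expmx B)) / 2.
Proof.
move=> hA hB; rewrite -subr_ge0.
pose sq := (id \* id) : R -> R.
pose ie := (id \* expR) : R -> R.
(* The ten monomials of (x - y)^2 (exp x + exp y) / 2 - (x - y) (exp x - exp y). *)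
have : 0 <= \sum_(p <- [:: (2^-1, (sq \* expR, cst 1)); (-1, (ie, id));
    (2^-1, (expR, sq)); (2^-1, (sq, expR)); (-1, (id, ie));
    (2^-1, (cst 1, sq \* expR)); (-1, (ie, cst 1)); (1, (id, expR));
    (1, (expR, id)); (-1, (cst 1, ie))])
    p.1 * rtr (funmx p.2.1 A *m funmx p.2.2 B).
  apply: rtr_funmx2_ge0 => x y; rewrite !big_cons !big_nil/= /sq /ie /=.
  have := expR_trapezoid x y; lra.
rewrite !big_cons !big_nil/= !funmx1 !mulmx1 !mul1mx /sq /ie -!funmxM.
rewrite -!funmx_id// -/(expmx A) -/(expmx B).
have := expmxC hA; have := expmxC hB.
move: (expmx A) (expmx B) => EA EB cB cA.
rewrite !(mulmxDl, mulmxDr, mulmxBl, mulmxBr, mulNmx, mulmxN, rtrD, rtrB, rtrN).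
(* A and B need not commute; cyclicity of the trace and the commutation of each matrix with its own
   exponential suffice to put the functions of A before those of B. *)
have -> : rtr (A *m B *m EA) = rtr (A *m EA *m B) by rewrite rtrC mulmxA -cA.
have -> : rtr (B *m A *m EA) = rtr (A *m EA *m B) by rewrite -mulmxA rtrC.
have -> : rtr (B *m B *m EA) = rtr (EA *m (B *m B)) by rewrite rtrC.
have -> : rtr (B *m A *m EB) = rtr (A *m (B *m EB)) by rewrite rtrC mulmxA -cB rtrC.
have -> : rtr (A *m B *m EB) = rtr (A *m (B *m EB)) by rewrite mulmxA.
have -> : rtr (B *m EA) = rtr (EA *m B) by rewrite rtrC.
lra.
Qed.
End trace_inequalities.

(** * Adding a multiple of a contraction to the exponent *)

Section trace_shift.
Import numFieldNormedType.Exports.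
Variables (R : realType) (n : nat).
Implicit Types (A B X U V : 'M[R[i]]_n).

Lemma unitarymx_tmul U : U \is unitarymx -> U ^t* *m U = 1%:M.
Proof. by move=> /unitarymxP /mulmx1C. Qed.

(** The functional calculus does not depend on the eigenbasis: O = V U^t* satisfies O_ij f_j = h_i
    O_ij, so f_j = h_i wherever O_ij is nonzero, and there g may be applied to both. *)
Lemma spectral_mx_comp U V (f h : 'I_n -> R) (g : R -> R) :
  U \is unitarymx -> V \is unitarymx -> spectral_mx U f = spectral_mx V h ->
  spectral_mx U (g \o f) = spectral_mx V (g \o h).
Proof.
move=> uU uV; have := unitarymx_tmul uU; have := unitarymx_tmul uV.
move: uU uV => /unitarymxP + /unitarymxP; rewrite !spectral_mx.unlock.
move: (U ^t*) (V ^t*) => U' V' UU' VV' V'V U'U E.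
have H : V *m U' *m diag_mx (\row_i (f i)%:C) =
         diag_mx (\row_i (h i)%:C) *m (V *m U').
  have := congr1 (fun M => V *m M *m U') E.
  by rewrite -!mulmxA UU' mulmx1 !mulmxA VV' mul1mx. 
have K : V *m U' *m diag_mx (\row_i ((g \o f) i)%:C) =
         diag_mx (\row_i ((g \o h) i)%:C) *m (V *m U').
  move: (V *m U') H => O /matrixP H; apply/matrixP => i j.
  have := H i j; rewrite !mul_mx_diag !mul_diag_mx !mxE.
  have [->|Oij] := eqVneq (O i j) 0; first by move=> _; rewrite mul0r !mulr0.
  by rewrite [RHS]mulrC => /(mulfI Oij) [] /= ->; rewrite mulrC.
have := congr1 (fun M => V' *m M *m U) K.
by rewrite -!mulmxA U'U mulmx1 !mulmxA V'V mul1mx.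
Qed.

Lemma funmx_spectral U (f : 'I_n -> R) (g : R -> R) : U \is unitarymx ->
  funmx g (spectral_mx U f) = spectral_mx U (g \o f).
Proof.
move=> uU; have := esym (funmx_id (spectral_herm U f)).
exact: (@spectral_mx_comp _ _ _ _ g (spectral_unitarymx _) uU).
Qed.

Lemma expmxDs (s : R) A : A \is hermsymmx ->
  expmx (A + s%:C%:M) = (expR s)%:C *: expmx A.
Proof.
move=> hA; have uA := spectral_unitarymx A.
rewrite {1}(funmx_id hA) -scalemx1 -(spectral_mx1 uA) [funmx id A]/funmx.
rewrite spectral_mxZ spectral_mxD /expmx funmx_spectral// spectral_mxZ.
by congr spectral_mx; apply/funext => i /=; rewrite mulr1 expRD mulrC.
Qed.

Lemma rtr_spectral_expmx_ge0 U (x : 'I_n -> R) A : (forall i, 0 <= x i) ->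
  0 <= rtr (spectral_mx U x *m expmx A).
Proof.
move=> x0; rewrite rtr_spectral2; apply: sumr_ge0 => i _; apply: sumr_ge0 => j _.
by rewrite !mulr_ge0 ?overlap_ge0 ?expR_ge0.
Qed.

Section one_step.
Variables (U : 'M[R[i]]_n) (x : 'I_n -> R).
Hypotheses (uU : U \is unitarymx) (x01 : forall i, 0 <= x i <= 1).
Let X := spectral_mx U x.

(** Since x^2 <= x on [0, 1] and exp A is positive. This closes the differential inequality, by
    returning the second-order term to Tr X exp. *)
Lemma contraction_sq A : rtr (X *m X *m expmx A) <= rtr (X *m expmx A).
Proof.
rewrite -subr_ge0 -rtrB -mulmxBl /X spectral_mxM// -[- spectral_mx _ _]scaleN1r.
rewrite -(rmorph1 (real_complex R)) -rmorphN spectral_mxZ spectral_mxD.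
apply: rtr_spectral_expmx_ge0 => i; rewrite mulN1r subr_ge0.
by have /andP[? ?] := x01 i; rewrite ler_piMl.
Qed.

Let hX : X \is hermsymmx. Proof. exact: spectral_herm. Qed.

(* The first part is an Euler step of the differential inequality f' <= f for
   f t = Tr (X exp (B + t X)). *)
Lemma expmx_small_step (e : R) B : 0 < e -> B \is hermsymmx ->
  let E := expmx (B + e%:C *: X) in
  rtr (X *m E) * (1 - e / 2) <= rtr (X *m expmx B) * (1 + e / 2) /\
  rtr E <= rtr (expmx B) + e * rtr (X *m E).
Proof.
move=> e0 hB; set A := B + _ => E; have hA : A \is hermsymmx := hermD hB (hermZ e hX).
have AB : A - B = e%:C *: X by rewrite /A addrC addKr.
have hA1 := contraction_sq A; have hB1 := contraction_sq B.
have hT := rtr_expmx_trapezoid hA hB; have hK := klein hB hA.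
rewrite -[B - A]opprB AB mulNmx rtrN -scalemxAl rtrZ in hK.
rewrite AB -!scalemxAl -!scalemxAr -!scalemxAl !rtrZ in hT.
rewrite mulmxBr mulmxDr rtrB rtrD -!mulrA ler_pM2l// in hT.
move: hA1 hB1 hT hK; rewrite -/E.
move: (rtr (X *m X *m E)) (rtr (X *m X *m expmx B)) => u v.
move: (rtr (X *m E)) (rtr (X *m expmx B)) (rtr E) (rtr (expmx B)) => a b c d.
by move=> h1 h2; have := ler_wpM2l (ltW e0) (lerD h1 h2); split; lra.
Qed.

(** The second bound is a geometric sum: e (r + ... + r^N) = (1 + e/2) (r^N - 1), because r (1 -
    e/2) = 1 + e/2. *)
Lemma expmx_steps (e : R) B (N : nat) : 0 < e < 2 -> B \is hermsymmx ->
  let r := (1 + e / 2) / (1 - e / 2) in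
  let E := expmx (B + (e *+ N)%:C *: X) in
  rtr (X *m E) <= r ^+ N * rtr (X *m expmx B) /\
  rtr E <= rtr (expmx B) + (1 + e / 2) * (r ^+ N - 1) * rtr (X *m expmx B).
Proof.
move=> /andP[e0 e2] hB r; have e2' : 0 < 1 - e / 2 by lra.
have rE : r * (1 - e / 2) = 1 + e / 2 by rewrite /r divfK// gt_eqF.
clearbody r; elim: N => [|N].
  by rewrite mulr0n scale0r addr0 expr0 mul1r subrr mulr0 mul0r addr0.
have hB' : B + (e *+ N)%:C *: X \is hermsymmx := hermD hB (hermZ (e *+ N) hX).
have -> : B + (e *+ N.+1)%:C *: X = B + (e *+ N)%:C *: X + e%:C *: X.
  by rewrite mulrSr rmorphD/= scalerDl addrA.
have := expmx_small_step e0 hB'; move: (B + (e *+ N)%:C *: X) => B'.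
move: (expmx (B' + _)) => E /=.
move: (rtr (X *m E)) (rtr (X *m expmx B)) (rtr (X *m expmx B')) => q p p'.
move: (rtr E) (rtr (expmx B)) (rtr (expmx B')) => f f0 f'.
rewrite exprS; move: (r ^+ N) => s [h1 h2] [IH1 IH2].
have {}h1 : q <= r * s * p.
  rewrite -(ler_pM2r e2') (le_trans h1)//.
  rewrite [X in _ <= X](_ : _ = s * p * (r * (1 - e / 2))); last by ring.
  by rewrite rE ler_pM2r//; lra.
split => //; apply: (le_trans h2); apply: (le_trans (lerD IH2 (ler_wpM2l (ltW e0) h1))).
rewrite le_eqVlt; apply/orP; left; apply/eqP.
apply/eqP; rewrite -subr_eq0; apply/eqP.
transitivity (s * p * ((1 + e / 2) - r * (1 - e / 2))); first by field.
by rewrite rE subrr mulr0.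
Qed.

Lemma rtr_expmx_shift_ge0 (t : R) B : 0 <= t -> B \is hermsymmx ->
  rtr (expmx (B + t%:C *: X)) <=
  rtr (expmx B) + (expR t - 1) * rtr (X *m expmx B).
Proof.
rewrite le_eqVlt => /predU1P[<- _|t0 hB].
  by rewrite scale0r addr0 expR0 subrr mul0r addr0.
set p := rtr (X *m expmx B).
have p0 : 0 <= p by apply: rtr_spectral_expmx_ge0 => i; have /andP[] := x01 i.
(* [F (y N)] dominates the result of N+1 steps of length e = 2 y = t / (N+1): there r = 1 + 2y / (1
   - y) <= exp(2y / (1 - y)), hence r^(N+1) <= exp(t / (1 - y)). The value [F 0] is the bound
   sought. *)
pose F (y : R) := rtr (expmx B) + (1 + y) * (expR (t / (1 - y)) - 1) * p.
pose y (N : nat) := t / 2 * N.+1%:R^-1.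
have y0 : y N @[N --> \oo] --> (0 : R).
  rewrite -(mulr0 (t / 2)); apply: cvgM; first exact: cvg_cst.
  exact: cvg_harmonic.
have : F (y N) @[N --> \oo] --> F 0.
  apply: cvgD; first exact: cvg_cst.
  apply: cvgM; last exact: cvg_cst.
  apply: cvgM; first by apply: cvgD => //; exact: cvg_cst.
  apply: cvgB; last exact: cvg_cst.
  apply: (@cvg_comp _ _ _ (fun N => t / (1 - y N)) (@expR R) _ (nbhs (t / (1 - 0)))).
    apply: cvgM; first exact: cvg_cst.
    apply: cvgV; first by rewrite subr0 oner_eq0.
    by apply: cvgB => //; exact: cvg_cst.
  exact: continuous_expR.
rewrite {2}/F subr0 divr1 addr0 mul1r => FF.
rewrite -(cvg_lim (@Rhausdorff R) FF); apply: limr_ge.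
  by apply/cvg_ex; eexists; exact: FF.
have [M _ HM] : \forall N \near \oo, y N < 1.
  by apply: (cvgr_lt _ y0); exact: ltr01.
exists M => // N /HM/= yN1; rewrite /F.
have yN0 : 0 < y N by rewrite mulr_gt0 ?divr_gt0 ?invr_gt0.
have e02 : 0 < 2 * y N < 2 by lra.
have [_] := expmx_steps N.+1 e02 hB.
have -> : 2 * y N *+ N.+1 = t.
  by rewrite /y -mulr_natr mulrA -mulrA mulVf ?pnatr_eq0// mulr1; field.
rewrite -/p; have -> : 2 * y N / 2 = y N by field.
move: (rtr (expmx B)) (rtr (expmx _)) => f0 f.
move=> /le_trans; apply; rewrite lerD2l ler_wpM2r// ler_wpM2l//; first by lra.
rewrite lerD2r.
have -> : t / (1 - y N) = N.+1%:R * (2 * y N / (1 - y N)).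
  rewrite mulrA; congr (_ / _).
  have : N.+1%:R != 0 :> R by rewrite pnatr_eq0.
  by rewrite /y; move: (N.+1%:R) => z z0; field.
rewrite expRM_natl; apply: lerXn2r; rewrite ?nnegrE ?expR_ge0//.
  by apply: divr_ge0; lra.
apply: le_trans (expR_ge1Dx _); rewrite le_eqVlt; apply/orP; left; apply/eqP.
by field; lra.
Qed.

End one_step.

(* Negative t reduces to positive t through X := 1 - X. *)
Lemma rtr_expmx_shift U (x : 'I_n -> R) (t : R) B : U \is unitarymx ->
  (forall i, 0 <= x i <= 1) -> B \is hermsymmx ->
  rtr (expmx (B + t%:C *: spectral_mx U x)) <=
  rtr (expmx B) + (expR t - 1) * rtr (spectral_mx U x *m expmx B).
Proof.
move=> uU x01 hB; have [t0|t0] := leP 0 t; first exact: rtr_expmx_shift_ge0.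
have x01' i : 0 <= 1 + -1 * x i <= 1 by have := x01 i; lra.
have t0' : 0 <= - t by lra.
have := rtr_expmx_shift_ge0 uU x01' t0' hB.
rewrite -spectral_mxD -spectral_mxZ spectral_mx1//.
rewrite (_ : (-1)%:C = -1 :> R[i]) ?scaleN1r; last by rewrite rmorphN rmorph1.
set X := spectral_mx U x.
have -> : B + (- t)%:C *: (1%:M - X) = B + t%:C *: X + (- t)%:C%:M.
  by rewrite scalerBr scalemx1 rmorphN scaleNr opprK addrA addrAC.
have hBX : B + t%:C *: X \is hermsymmx := hermD hB (hermZ t (spectral_herm _ _)).
(* The scalar part of 1 - X contributes the factor exp(-t). Multiplying by exp t leaves exp(t) (a +
   (exp(-t) - 1) (a - b)) = a + (exp(t) - 1) b. *)
rewrite expmxDs// rtrZ mulmxBl mul1mx rtrB => /(ler_wpM2l (expR_ge0 t)).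
rewrite mulrA -expRD subrr expR0 mul1r => /le_trans; apply.
move: (rtr (expmx B)) (rtr (X *m expmx B)) => a b.
rewrite (_ : expR t * _ = expR t * a + (expR t * expR (- t) - expR t) * (a - b)).
  by rewrite expRxMexpNx_1; lra.
by ring.
Qed.

End trace_shift.

(** * Sums of extreme eigenvalues *)

Section real_eigenvalues.
Variables (R : realType) (n : nat).
Implicit Types (A B U V : 'M[R[i]]_n).

Let geqT : total (fun x y : R => y <= x). Proof. by move=> x y; exact: le_total. Qed.
Let geq_trans : transitive (fun x y : R => y <= x).
Proof. by move=> x y z yx zy; exact: le_trans zy yx. Qed.
Let geq_anti : antisymmetric (fun x y : R => y <= x).
Proof. by move=> x y /andP[yx xy]; apply/le_anti; rewrite xy yx. Qed.
Let geq_refl : reflexive (fun x y : R => y <= x). Proof. exact: lexx. Qed.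

Lemma char_poly_spectral U (f : 'I_n -> R) : U \is unitarymx ->
  char_poly (spectral_mx U f) = \prod_(i < n) ('X - ((f i)%:C)%:P).
Proof.
move=> uU; have := unitarymx_tmul uU; rewrite spectral_mx.unlock.
move: (U ^t*) => W WU; set D := diag_mx _.
transitivity (char_poly D).
  rewrite /char_poly.
  have -> : char_poly_mx (W *m D *m U) =
      map_mx polyC W *m char_poly_mx D *m map_mx polyC U.
    rewrite /char_poly_mx mulmxBr mulmxBl -!map_mxM; congr (_ - _).
    by rewrite mul_mx_scalar -scalemxAl -map_mxM WU map_mx1 scalemx1.
  rewrite !det_mulmx mulrAC -det_mulmx -map_mxM WU map_mx1 det1 mul1r//.
rewrite char_poly_trig ?diag_mx_is_trig//; apply: eq_bigr => i _.
by rewrite !mxE eqxx mulr1n.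
Qed.

(** Unique factorization of the characteristic polynomial determines its roots as a multiset and
    sorting fixes their order, so any unitary diagonalization computes the eigenvalues. *)
Lemma real_eigenvalues_spectral U (f : 'I_n -> R) : U \is unitarymx ->
  real_eigenvalues (spectral_mx U f) =
  sort (fun x y : R => y <= x) [seq f i | i <- enum 'I_n].
Proof.
move=> uU; rewrite /real_eigenvalues; apply/perm_sortP => //.
rewrite /eigenvalues; case: closed_field_poly_normal => s /=.
rewrite (monicP (char_poly_monic _)) scale1r char_poly_spectral// => E.
have /prod_XsubC_eq /(perm_map (@complex.Re R)) :
    \prod_(z <- s) ('X - z%:P) =
    \prod_(z <- [seq (f i)%:C | i <- enum 'I_n]) ('X - z%:P).
  by rewrite -E big_map big_enum.
by rewrite -map_comp.
Qed.

Lemma real_eigenvaluesE A : A \is hermsymmx -> real_eigenvalues A =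
  sort (fun x y : R => y <= x) [seq eigval A i | i <- enum 'I_n].
Proof.
move=> hA; rewrite [in LHS](funmx_id hA) [funmx id A]/funmx.
by rewrite real_eigenvalues_spectral ?spectral_unitarymx.
Qed.

Lemma size_real_eigenvalues A : A \is hermsymmx -> size (real_eigenvalues A) = n.
Proof. by move=> hA; rewrite real_eigenvaluesE// size_sort size_map size_enum_ord. Qed.

Lemma sum_real_eigenvalues (h : R -> R) A : A \is hermsymmx ->
  \sum_(0 <= j < n) h (nth 0 (real_eigenvalues A) j) = \sum_i h (eigval A i).
Proof.
move=> hA; transitivity (\sum_(x <- real_eigenvalues A) h x).
  by rewrite [RHS](big_nth 0) size_real_eigenvalues.
rewrite real_eigenvaluesE//.
by rewrite (perm_big _ (permEl (perm_sort _ _))) big_map big_enum.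
Qed.

Lemma real_eigenvalues_sorted A :
  sorted (fun x y : R => y <= x) (real_eigenvalues A).
Proof. exact: sort_sorted. Qed.

Lemma real_eigenvalues_geq A i j : A \is hermsymmx -> (i <= j < n)%N ->
  nth 0 (real_eigenvalues A) j <= nth 0 (real_eigenvalues A) i.
Proof.
move=> hA /andP[ij jn].
apply: (sorted_leq_nth geq_trans geq_refl 0 (real_eigenvalues_sorted A)) => //;
  by rewrite inE size_real_eigenvalues// (leq_ltn_trans ij).
Qed.

Lemma eigval_bounds A i : A \is hermsymmx ->
  lambda n A <= eigval A i <= lambda 1 A.
Proof.
move=> hA; have : eigval A i \in real_eigenvalues A.
  by rewrite real_eigenvaluesE// mem_sort map_f// mem_enum.
move=> /(nthP 0)[j]; rewrite size_real_eigenvalues// => jn <-.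
have n0 : (0 < n)%N by exact: leq_ltn_trans jn.
by rewrite /lambda; apply/andP; split; apply: real_eigenvalues_geq => //; lia.
Qed.

Definition top_sum k A : R := \sum_(1 <= j < k.+1) lambda j A.
Definition bot_sum k A : R := \sum_(1 <= j < k.+1) lambda (n - j + 1) A.

Lemma top_sumE k A :
  top_sum k A = \sum_(0 <= j < k) nth 0 (real_eigenvalues A) j.
Proof. by rewrite /top_sum big_add1. Qed.

(* With top_sum_attained: the sum of the k largest eigenvalues is the minimum over t
   of k t + sum_i (a_i - t)^+, a form in which subadditivity is immediate. *)
Lemma top_sum_le k (t : R) A : A \is hermsymmx -> (k <= n)%N ->
  top_sum k A <= k%:R * t + \sum_i Num.max (eigval A i - t) 0.
Proof.
move=> hA kn; rewrite top_sumE -(sum_real_eigenvalues (fun x => Num.max (x - t) 0))//.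
rewrite (big_cat_nat (leq0n k) kn)/= addrA.
rewrite -[leLHS]addr0 lerD//; last first.
  by apply: sumr_ge0 => j _; rewrite le_max lexx orbT.
have -> : k%:R * t = \sum_(0 <= j < k) t by rewrite sumr_const_nat subn0 mulr_natl.
rewrite -big_split/=; apply: ler_sum => j _.
by rewrite -lerBlDl le_max lexx.
Qed.

Lemma top_sum_attained k A : A \is hermsymmx -> (0 < k <= n)%N ->
  exists t : R, top_sum k A = k%:R * t + \sum_i Num.max (eigval A i - t) 0.
Proof.
(* The threshold is the k-th largest eigenvalue, at position k - 1: the positive part is a_i - t up
   to that position and 0 after it. *)
move=> hA /andP[k0 kn]; pose t := nth 0 (real_eigenvalues A) k.-1.
exists t; rewrite top_sumE -(sum_real_eigenvalues (fun x => Num.max (x - t) 0))//.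
rewrite (big_cat_nat (leq0n k) kn)/= addrA [X in _ + X]big1_seq ?addr0; last first.
  move=> j; rewrite mem_index_iota => /andP[_ /andP[kj jn]].
  rewrite max_r// subr_le0 real_eigenvalues_geq// jn andbT.
  by rewrite (leq_trans _ kj)// leq_pred.
have -> : k%:R * t = \sum_(0 <= j < k) t by rewrite sumr_const_nat subn0 mulr_natl.
rewrite -big_split/=; apply: eq_big_nat => j /andP[_ jk].
have tj : t <= nth 0 (real_eigenvalues A) j.
  by apply: real_eigenvalues_geq => //; lia.
by rewrite max_l ?subr_ge0// addrC subrK.
Qed.

(** The spectral matrix of an indicator is the projection onto the i-th eigenvector v_i of V, so the
    left side is the quadratic form of A at v_i. *)
Lemma rtr_diag_entry A V (i : 'I_n) : A \is hermsymmx ->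
  rtr (spectral_mx V (fun j => (j == i)%:R) *m A) =
  \sum_j eigval A j * overlap V (spectralmx A) i j.
Proof.
move=> hA; rewrite {1}(funmx_id hA) [funmx id A]/funmx rtr_spectral2.
rewrite (bigD1 i)//= [X in _ + X]big1 ?addr0; last first.
  by move=> l /negPf li; apply: big1 => j _; rewrite li !mul0r.
by apply: eq_bigr => j _; rewrite eqxx mul1r.
Qed.

Lemma eigval_sum A B i : A \is hermsymmx -> B \is hermsymmx ->
  let V := spectralmx (A + B) in
  eigval (A + B) i = \sum_j eigval A j * overlap V (spectralmx A) i j +
                     \sum_j eigval B j * overlap V (spectralmx B) i j.
Proof.
move=> hA hB V; have uV : V \is unitarymx := spectral_unitarymx _.
rewrite -!rtr_diag_entry// -rtrD -mulmxDr.
rewrite [in RHS](funmx_id (hermD hA hB)) [funmx id _]/funmx spectral_mxM//.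
rewrite rtr_spectral// (bigD1 i)//= eqxx mul1r big1 ?addr0// => j /negPf ->.
by rewrite mul0r.
Qed.

(** If a and b are optimal thresholds for A and B, then a + b is a threshold for A + B. Each
    eigenvalue of A + B is a weighted mean of those of A plus one of those of B; the positive part
    is subadditive and convex, and summing over i restores the unweighted sums because the columns
    of [overlap] sum to 1. *)
Lemma top_sumD k A B : A \is hermsymmx -> B \is hermsymmx -> (0 < k <= n)%N ->
  top_sum k (A + B) <= top_sum k A + top_sum k B.
Proof.
move=> hA hB kn; have [a ->] := top_sum_attained hA kn.
have [b ->] := top_sum_attained hB kn.
have kn' : (k <= n)%N by case/andP: kn.
apply: (le_trans (top_sum_le (a + b) (hermD hA hB) kn')).
rewrite mulrDr addrACA lerD2l.
set V := spectralmx (A + B); have uV : V \is unitarymx := spectral_unitarymx _.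
have avg (C : 'M[R[i]]_n) c : \sum_i \sum_j Num.max (eigval C j - c) 0 *
    overlap V (spectralmx C) i j = \sum_j Num.max (eigval C j - c) 0.
  rewrite exchange_big; apply: eq_bigr => j _.
  by rewrite -mulr_sumr (overlap_col j uV (spectral_unitarymx C)) mulr1.
rewrite -(avg A a) -(avg B b) -big_split/=; apply: ler_sum => i _.
have shift (C : 'M[R[i]]_n) c : \sum_j eigval C j * overlap V (spectralmx C) i j - c <=
    \sum_j Num.max (eigval C j - c) 0 * overlap V (spectralmx C) i j.
  rewrite -[X in _ - X]mulr1 -(overlap_row i uV (spectral_unitarymx C)) mulr_sumr.
  rewrite -sumrB; apply: ler_sum => j _.
  by rewrite -mulrBl ler_wpM2r ?overlap_ge0// le_max lexx.
have pos (C : 'M[R[i]]_n) c :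
    0 <= \sum_j Num.max (eigval C j - c) 0 * overlap V (spectralmx C) i j.
  by apply: sumr_ge0 => j _; rewrite mulr_ge0 ?overlap_ge0// le_max lexx orbT.
rewrite ge_max addr_ge0// andbT eigval_sum//.
rewrite opprD addrACA lerD//.
Qed.

Lemma real_eigenvaluesZ (t : R) A : 0 <= t -> A \is hermsymmx ->
  real_eigenvalues (t%:C *: A) = [seq t * x | x <- real_eigenvalues A].
Proof.
move=> t0 hA; rewrite {1}(funmx_id hA) [funmx id A]/funmx spectral_mxZ.
rewrite real_eigenvalues_spectral ?spectral_unitarymx// real_eigenvaluesE//.
apply: (sorted_eq geq_trans geq_anti); first exact: sort_sorted.
  by apply: homo_sorted (sort_sorted geqT _) => x y; exact: ler_wpM2l.
rewrite perm_sort (map_comp ( *%R t)) perm_map// perm_sym.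
by rewrite perm_sort.
Qed.

Lemma lambdaZ (t : R) A j : 0 <= t -> A \is hermsymmx -> (0 < j <= n)%N ->
  lambda j (t%:C *: A) = t * lambda j A.
Proof.
move=> t0 hA /andP[j0 jn]; rewrite /lambda real_eigenvaluesZ// (nth_map 0)//.
by rewrite size_real_eigenvalues// prednK.
Qed.

Lemma lambdaN A j : A \is hermsymmx -> (0 < j <= n)%N ->
  lambda j (- A) = - lambda (n - j + 1)%N A.
Proof.
move=> hA /andP[j0 jn].
have E : real_eigenvalues (- A) = rev [seq - x | x <- real_eigenvalues A].
  rewrite (real_eigenvaluesE hA) {1}(funmx_id hA) [funmx id A]/funmx.
  rewrite -scaleN1r -(rmorph1 (real_complex R)) -rmorphN spectral_mxZ.
  rewrite real_eigenvalues_spectral ?spectral_unitarymx//.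
  apply: (sorted_eq geq_trans geq_anti); first exact: sort_sorted.
    rewrite rev_sorted; apply: homo_sorted (sort_sorted geqT _) => x y.
    by rewrite lerN2.
  rewrite perm_sort perm_sym perm_rev.
  have -> : [seq -1 * eigval A i | i <- enum 'I_n] =
      [seq - x | x <- [seq eigval A i | i <- enum 'I_n]].
    by rewrite -[RHS]map_comp; apply: eq_map => i /=; rewrite mulN1r.
  by rewrite perm_map// perm_sort.
have sA := size_real_eigenvalues hA.
rewrite /lambda E nth_rev ?size_map ?sA; last by lia.
rewrite (nth_map 0) ?sA; last by lia.
by congr (- nth 0 _ _); lia.
Qed.

Lemma top_sumZ (t : R) k A : 0 <= t -> A \is hermsymmx -> (k <= n)%N ->
  top_sum k (t%:C *: A) = t * top_sum k A.
Proof.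
move=> t0 hA kn; rewrite /top_sum mulr_sumr; apply: eq_big_nat => j /andP[j0 jk].
by rewrite lambdaZ// j0 (leq_trans _ kn).
Qed.

Lemma top_sumN k A : A \is hermsymmx -> (k <= n)%N ->
  top_sum k (- A) = - bot_sum k A.
Proof.
move=> hA kn; rewrite /top_sum /bot_sum -sumrN; apply: eq_big_nat => j /andP[j0 jk].
by rewrite lambdaN// j0 (leq_trans _ kn).
Qed.

Lemma bot_le_top k A : A \is hermsymmx -> (k <= n)%N -> bot_sum k A <= top_sum k A.
Proof.
move=> hA kn; rewrite /top_sum /bot_sum big_nat_rev/=.
rewrite big_nat [leRHS]big_nat; apply: ler_sum => j /andP[j0 jk].
apply: real_eigenvalues_geq => //.
have : (0 < j <= k)%N by rewrite j0.
by move: kn => + /andP[? ?]; lia.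
Qed.

Lemma expR_top_sum k A : A \is hermsymmx -> (0 < k <= n)%N ->
  k%:R * expR (top_sum k A / k%:R) <= rtr (expmx A).
Proof.
move=> hA /andP[k0 kn]; rewrite rtr_spectral ?spectral_unitarymx//.
rewrite -(sum_real_eigenvalues expR)// (big_cat_nat (leq0n k) kn)/=.
rewrite -[leLHS]addr0 lerD//; last by apply: sumr_ge0 => j _; exact: expR_ge0.
(* Tangents at the mean [m] of the k largest eigenvalues: the deviations cancel, so the tangent
   values add up to k exp m. *)
rewrite top_sumE; set m := _ / _.
have -> : k%:R * expR m = \sum_(0 <= j < k)
    (expR m + expR m * (nth 0 (real_eigenvalues A) j - m)).
  rewrite big_split/= sumr_const_nat subn0 -mulr_sumr sumrB sumr_const_nat subn0.
  have -> : \sum_(0 <= j < k) nth 0 (real_eigenvalues A) j = m * k%:R.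
    by rewrite /m divfK// pnatr_eq0 -lt0n.
  by rewrite mulr_natr subrr mulr0 addr0 mulr_natl.
by apply: ler_sum => j _; exact: expR_tangent.
Qed.

Lemma rtr_expmxE A : A \is hermsymmx ->
  rtr (expmx A) = \sum_(0 <= j < n) expR (nth 0 (real_eigenvalues A) j).
Proof.
by move=> hA; rewrite rtr_spectral ?spectral_unitarymx// sum_real_eigenvalues.
Qed.

End real_eigenvalues.

(** * Independence *)

Section independence.
Local Open Scope ereal_scope.
Context d (T : measurableType d) (R : realType) (P : probability T R).

Section product_expectation.
Variables u w : T -> R.
Hypotheses (mu : measurable_fun setT u) (mw : measurable_fun setT w).
Hypothesis uw_indep : forall A B, measurable A -> measurable B ->
  P (u @^-1` A `&` w @^-1` B) = P (u @^-1` A) * P (w @^-1` B).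

HB.instance Definition _ := isMeasurableFun.Build _ _ _ _ u mu.
HB.instance Definition _ := isMeasurableFun.Build _ _ _ _ w mw.

Let uw (x : T) := (u x, w x).
Let muw : measurable_fun setT uw. Proof. exact: measurable_fun_pair. Qed.
HB.instance Definition _ := isMeasurableFun.Build _ _ _ _ uw muw.

(** Independence on rectangles determines the joint law, so that Fubini applies to the product law
    on R * R. *)
Let law_uw A : measurable A ->
  (distribution P u \x distribution P w) A = distribution P uw A.
Proof. by move=> mA; exact: product_measure_unique. Qed.

Hypotheses (iu : P.-integrable setT (EFin \o u))
  (iw : P.-integrable setT (EFin \o w)).

Let iu' : (distribution P u).-integrable setT (EFin : R -> \bar R).
Proof.
apply/integrableP; split => //.
rewrite (ge0_integral_distribution u)//=; last first.
  by apply/measurable_EFinP; exact: normr_measurable.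
by have /integrableP[] := iu.
Qed.

Let iw' : (distribution P w).-integrable setT (EFin : R -> \bar R).
Proof.
apply/integrableP; split => //.
rewrite (ge0_integral_distribution w)//=; last first.
  by apply/measurable_EFinP; exact: normr_measurable.
by have /integrableP[] := iw.
Qed.

Let mprod : measurable_fun setT (fun z : R * R => (z.1 * z.2)%:E).
Proof.
apply/measurable_EFinP.
by apply: measurable_funM; [exact: measurable_fst|exact: measurable_snd].
Qed.

Let iprod : (distribution P u \x distribution P w).-integrable setT
  (fun z : R * R => (z.1 * z.2)%:E).
Proof.
apply/integrable12ltyP => //.
under eq_integral => x _.
  under eq_integral => y _ do rewrite /= normrM EFinM.
  rewrite ge0_integralZl//; last by apply: measurableT_comp => //; exact: measurableT_comp.
  over.
have /integrableP[_ hw] := iw'; have /integrableP[_ hu] := iu'.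
rewrite ge0_integralZr//.
- by rewrite lte_mul_pinfty// ?integral_ge0// ge0_fin_numE ?integral_ge0.
- by apply/measurable_EFinP; exact: normr_measurable.
- exact: integral_ge0.
Qed.

Lemma integrable_prod_indep : P.-integrable setT (fun x => (u x * w x)%:E).
Proof.
have /integrableP[_ h] := iprod; apply/integrableP; split.
  by apply/measurable_EFinP; exact: measurable_funM.
move: h; rewrite (eq_measure_integral (distribution P uw)); last first.
  by move=> A mA _; exact: law_uw.
by rewrite (ge0_integral_distribution uw)//; exact: measurableT_comp.
Qed.

Lemma integral_prod_indep :
  \int[P]_x (u x * w x)%:E = \int[P]_x (u x)%:E * \int[P]_x (w x)%:E.
Proof.
have -> : \int[P]_x (u x * w x)%:E = \int[distribution P uw]_z (z.1 * z.2)%:E.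
  rewrite (@integral_distribution _ _ _ _ _ _ uw _ mprod)//.
  exact: integrable_prod_indep.
rewrite (eq_measure_integral (distribution P u \x distribution P w)%E); last first.
  by move=> A mA _; exact: (esym (law_uw mA)).
rewrite -integral12_prod_meas1// /fubini_F/=.
have fw : \int[distribution P w]_y y%:E \is a fin_num by exact: integrable_fin_num.
under eq_integral => x _.
  under eq_integral => y _ do rewrite /= EFinM.
  rewrite integralZl//.
  over.
rewrite -(fineK fw) integralZr// fineK//.
rewrite (@integral_distribution _ _ _ _ _ _ u _ _)//.
by rewrite (@integral_distribution _ _ _ _ _ _ w _ _).
Qed.

End product_expectation.
End independence.

(** * Borel sets of matrices and the events generated by a subfamily *)

Section borel_matrices.
Variables (R : realType) (n : nat).

Lemma mx_borel_sigma : sigma_algebra setT (@mx_borel R n).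
Proof. exact: smallest_sigma_algebra. Qed.

Lemma mx_borelT : mx_borel (setT : set 'M[R[i]]_n).
Proof. by have /(sigma_algebraP (fun A _ => @subsetT _ A))[] := mx_borel_sigma. Qed.

Lemma mx_borelI : setI_closed (@mx_borel R n).
Proof. by have /(sigma_algebraP (fun A _ => @subsetT _ A))[] := mx_borel_sigma. Qed.

Lemma mx_borel_Re (a b : 'I_n) (B : set R) : measurable B ->
  mx_borel [set A : 'M[R[i]]_n | B (complex.Re (A a b))].
Proof. by move=> mB; apply: sub_sigma_algebra; exists a, b, B; split=> //; left. Qed.

Lemma mx_borel_Im (a b : 'I_n) (B : set R) : measurable B ->
  mx_borel [set A : 'M[R[i]]_n | B (complex.Im (A a b))].
Proof. by move=> mB; apply: sub_sigma_algebra; exists a, b, B; split=> //; right. Qed.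

End borel_matrices.

Section cylinders.
Context d (T : measurableType d) (R : realType) (P : probability T R) (m n : nat).
Variable X : 'I_m -> T -> 'M[R[i]]_n.
Hypothesis mX : forall i, random_matrix (X i).
Hypothesis iX : independent_matrices P X.

(** A pi-system; the sigma-algebra it generates is the information carried by the X j with j in
    J. *)
Definition cylinders (J : {set 'I_m}) : set_system T :=
  [set E | exists B : 'I_m -> set 'M[R[i]]_n, (forall i, mx_borel (B i)) /\
    E = \bigcap_(i in [set` J]) (X i @^-1` B i)].

Lemma cylinders_measurable J : cylinders J `<=` measurable.
Proof.
move=> _ [B [mB ->]]; apply: fin_bigcap_measurable => [|i _]; last exact: mX.
exact: finite_finset.
Qed.

Lemma cylinders_setI J : setI_closed (cylinders J).
Proof.
move=> _ _ [A [mA ->]] [B [mB ->]]; exists (fun i => A i `&` B i); split.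
  by move=> i; exact: mx_borelI.
by rewrite -bigcapI.
Qed.

(** Both sides are finite measures in A that agree on the pi-system of cylinders, hence on the
    sigma-algebra it generates. *)
Lemma indep_cylinders (J : {set 'I_m}) i (A : set T) B : i \notin J ->
  <<s cylinders J >> A -> mx_borel B ->
  P (A `&` X i @^-1` B) = (P A * P (X i @^-1` B))%E.
Proof.
move=> iJ sA mB; have mXB : measurable (X i @^-1` B) by exact: mX.
pose m1 := mrestr P mXB.
pose p : {nonneg R} := NngNum (fine_ge0 (measure_ge0 P (X i @^-1` B))).
pose m2 := mscale p P.
rewrite -[LHS]/(m1 A) [RHS](_ : _ = m2 A); last first.
  by rewrite /m2/= /mscale/= fineK ?fin_num_measure// muleC.
apply: (g_sigma_algebra_measure_unique (cylinders J) (@cylinders_measurable J)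
  (fun=> setT)) => //.
- move=> _; exists (fun=> setT); split => [?|]; first exact: mx_borelT.
  by apply/seteqP; split => // w _ j _.
- by rewrite bigcup_const.
- exact: cylinders_setI.
- move=> _ [C [mC ->]]; rewrite /m1 /m2/= /mrestr/= /mscale/= fineK ?fin_num_measure//.
  (* One family over i |: J carries both events; it does not disturb C, since i is outside J. *)
  pose D j := if j == i then B else C j.
  have mD j : mx_borel (D j) by rewrite /D; case: ifP.
  have jD j : j \in J -> D j = C j.
    by rewrite /D; case: eqP => // ->; rewrite (negPf iJ).
  have := @iX (i |: J) D (fun j _ => mD j); rewrite big_setU1//= {2}/D eqxx.
  rewrite (eq_bigr (fun j => P (X j @^-1` C j))) => [|j jJ]; last by rewrite jD.
  rewrite -(@iX J C (fun j _ => mC j)) => <-; congr (P _).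
  apply/seteqP; split=> [w [Cw Bw] j /=|w Dw].
    rewrite !inE => /predU1P[->|jJ]; first by rewrite /D eqxx.
    by rewrite jD//; exact: Cw.
  split; last by have := Dw i; rewrite /= setU11 /D eqxx; apply.
  by move=> j /= jJ; rewrite -jD//; apply: Dw; rewrite /= inE jJ orbT.
- by move=> _; rewrite /m1 /= /mrestr setTI (le_lt_trans (probability_le1 P mXB))// ltry.
Qed.

End cylinders.

(** * Measurability *)

Section mx_measurable.
Import numFieldNormedType.Exports.
Context d (T : measurableType d) (R : realType) (n : nat).
Implicit Types F G : T -> 'M[R[i]]_n.

(** Stated by coordinates so that sums, products and limits reduce to real functions, and for any T,
    which may carry the coarser sigma-algebra generated by [cylinders]. *)
Definition mx_measurable F := forall a b,
  measurable_fun setT (fun w => complex.Re (F w a b)) /\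
  measurable_fun setT (fun w => complex.Im (F w a b)).

Lemma mx_measurable_cst (A : 'M[R[i]]_n) : mx_measurable (fun=> A).
Proof. by move=> a b; split; exact: measurable_cst. Qed.

Lemma mx_measurableD F G : mx_measurable F -> mx_measurable G ->
  mx_measurable (fun w => F w + G w).
Proof.
move=> mF mG a b; have [rF iF] := mF a b; have [rG iG] := mG a b; split.
  under eq_fun do rewrite mxE cReD; exact: measurable_funD.
under eq_fun do rewrite mxE cImD; exact: measurable_funD.
Qed.

Lemma mx_measurableM F G : mx_measurable F -> mx_measurable G ->
  mx_measurable (fun w => F w *m G w).
Proof.
move=> mF mG a b; split.
  under eq_fun do rewrite mxE cRe_sum; apply: measurable_sum => j.
  have [rF iF] := mF a j; have [rG iG] := mG j b.
  under eq_fun do rewrite cReM.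
  by apply: measurable_funB; exact: measurable_funM.
under eq_fun do rewrite mxE cIm_sum; apply: measurable_sum => j.
have [rF iF] := mF a j; have [rG iG] := mG j b.
under eq_fun do rewrite cImM.
by apply: measurable_funD; exact: measurable_funM.
Qed.

Lemma mx_measurableZ (t : R) F : mx_measurable F ->
  mx_measurable (fun w => t%:C *: F w).
Proof.
move=> mF; under eq_fun do rewrite -mul_scalar_mx.
by apply: mx_measurableM => //; exact: mx_measurable_cst.
Qed.

Lemma mx_measurable_sum (I : Type) (s : seq I) (F : I -> T -> 'M[R[i]]_n) :
  (forall j, mx_measurable (F j)) ->
  mx_measurable (fun w => \sum_(j <- s) F j w).
Proof.
move=> mF; elim: s => [|j s IH].
  by under eq_fun do rewrite big_nil; exact: mx_measurable_cst.
by under eq_fun do rewrite big_cons; exact: mx_measurableD.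
Qed.

Lemma measurable_rtr F : mx_measurable F ->
  measurable_fun setT (fun w => rtr (F w)).
Proof.
move=> mF; rewrite /rtr; under eq_fun do rewrite cRe_sum.
by apply: measurable_sum => j; case: (mF j j).
Qed.

Lemma mx_measurable_pow F k : (forall w, F w \is hermsymmx) ->
  mx_measurable F -> mx_measurable (fun w => funmx (fun x => x ^+ k) (F w)).
Proof.
move=> hF mF; elim: k => [|k IH].
  have E w : funmx (fun x => x ^+ 0) (F w) = 1%:M by rewrite -(funmx1 (F w)).
  by under eq_fun do rewrite E; exact: mx_measurable_cst.
have E w : funmx (fun x => x ^+ k.+1) (F w) = F w *m funmx (fun x => x ^+ k) (F w).
  rewrite {2}(funmx_id (hF w)) funmxM; congr funmx.
  by apply/funext => x /=; rewrite exprS.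
by under eq_fun do rewrite E; exact: mx_measurableM.
Qed.

(** Nothing is asked of the dependence of the eigenbasis on the matrix: exp is the pointwise limit
    of the partial sums of its series, which are polynomials in F. *)
Lemma mx_measurable_expmx F : (forall w, F w \is hermsymmx) ->
  mx_measurable F -> mx_measurable (fun w => expmx (F w)).
Proof.
move=> hF mF.
pose S N w := \sum_(k <- iota 0 N) (k`!%:R^-1)%:C *: funmx (fun x => x ^+ k) (F w).
have mS N : mx_measurable (S N).
  by apply: mx_measurable_sum => k; apply: mx_measurableZ; exact: mx_measurable_pow.
have SE N w : S N w = funmx (fun x => series (exp_coeff x) N) (F w).
  rewrite /S; elim: N => [|N IH].
    rewrite big_nil; apply/matrixP => a b; rewrite /funmx spectral_mxE mxE big1// => i _.
    by rewrite /= /series/= big_nil mulr0 mul0r.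
  rewrite -addn1 iotaD big_cat/= IH big_seq1 add0n /funmx spectral_mxZ spectral_mxD.
  congr spectral_mx; apply/funext => i /=; rewrite addn1 /series/= big_nat_recr//=.
  by rewrite exp_coeffE.
(* [g] stands for the real or the imaginary part. Real factors leave it, so convergence of an entry
   reduces to the scalar series at each eigenvalue. *)
have cvgE w a b (g : R[i] -> R) (lin : forall (x y : R[i]) (t : R),
    g (x * t%:C * y) = t * g (x * y)) (gD : {morph g : x y / x + y}) (g0 : g 0 = 0) :
    (fun N => g (S N w a b)) @ \oo --> g (expmx (F w) a b).
  have gE f : g (funmx f (F w) a b) = \sum_i f (eigval (F w) i) *
      g (Num.conj (spectralmx (F w) i a) * spectralmx (F w) i b).
    rewrite /funmx spectral_mxE (big_morph g gD g0); apply: eq_bigr => i _.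
    exact: lin.
  under eq_fun do rewrite SE gE; rewrite gE.
  apply: cvg_big => [|i _]; first exact: add_continuous.
  apply: cvgM; last exact: cvg_cst.
  have h := @is_cvg_series_exp_coeff R (eigval (F w) i); exact: h.
move=> a b; split.
  apply: (measurable_fun_cvg (h := fun N w => complex.Re (S N w a b))).
    by move=> N; case: (mS N a b).
  move=> w _; apply: cvgE => //; last exact: cReD.
  move=> [x y] [z t] s /=; ring.
apply: (measurable_fun_cvg (h := fun N w => complex.Im (S N w a b))).
  by move=> N; case: (mS N a b).
move=> w _; apply: cvgE => //; last exact: cImD.
move=> [x y] [z t] s /=; ring.
Qed.

(* The j-th eigenvalue is the limit of ln (sum_(l >= j) exp (N lambda_l)) / N, and
   this sum is Tr exp (N F) minus terms known to be measurable by induction. *)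
Lemma measurable_lambda F j : (forall w, F w \is hermsymmx) -> (0 < j <= n)%N ->
  mx_measurable F -> measurable_fun setT (fun w => lambda j (F w)).
Proof.
move=> hF + mF; rewrite /lambda; case: j => // j /= jn.
elim/ltn_ind: j jn => j IH jn.
pose tr N w : R := rtr (expmx ((N.+1%:R : R)%:C *: F w)).
have trE N w : tr N w = \sum_(0 <= l < n) expR (N.+1%:R * nth 0 (real_eigenvalues (F w)) l).
  rewrite /tr rtr_expmxE ?hermZ// real_eigenvaluesZ//.
  rewrite big_nat [RHS]big_nat; apply: eq_bigr => l /andP[_ ln].
  by rewrite (nth_map 0)// size_real_eigenvalues.
pose D N w := tr N w -
  \sum_(l < j) expR (N.+1%:R * nth 0 (real_eigenvalues (F w)) l).
have DE N w : D N w =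
    \sum_(j <= l < n) expR (N.+1%:R * nth 0 (real_eigenvalues (F w)) l).
  rewrite /D trE (big_cat_nat (leq0n j) (ltnW jn))/=.
  by rewrite big_mkord addrAC subrr add0r.
have mD N : measurable_fun setT (D N).
  apply: measurable_funB.
    apply: measurable_rtr; apply: mx_measurable_expmx.
      by move=> w; exact: hermZ.
    exact: mx_measurableZ.
  apply: measurable_sum => l; apply: measurableT_comp => //.
  apply: measurable_funM; first exact: measurable_cst.
  by apply: IH => //; exact: ltn_trans jn.
apply: (measurable_fun_cvg (h := fun N w => N.+1%:R^-1 * ln (D N w))).
  move=> N; apply: measurable_funM; first exact: measurable_cst.
  by apply: measurableT_comp => //; exact: measurable_ln.
move=> w _; set x := nth 0 _ j.
(* The remaining sum lies between its largest term and n times that term, so its logarithm divided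
   by N+1 exceeds x by at most ln n / (N+1). *)
have D1 N : expR (N.+1%:R * x) <= D N w.
  rewrite DE big_ltn// lerDl; apply: sumr_ge0 => l _; exact: expR_ge0.
have D2 N : D N w <= n%:R * expR (N.+1%:R * x).
  rewrite DE (@le_trans _ _ (\sum_(j <= l < n) expR (N.+1%:R * x)))//.
    rewrite big_nat [leRHS]big_nat; apply: ler_sum => l /andP[jl ln].
    by rewrite ler_expR ler_wpM2l// real_eigenvalues_geq// jl.
  by rewrite sumr_const_nat -[_ *+ (n - j)]mulr_natl ler_wpM2r ?expR_ge0// ler_nat leq_subr.
have n0 : (0 < n)%N by exact: leq_ltn_trans jn.
have D0 N : 0 < D N w by apply: lt_le_trans (D1 N); exact: expR_gt0.
apply: (@squeeze_cvgr _ _ _ _ (fun=> x) (fun N => x + ln n%:R * N.+1%:R^-1)).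
- apply: nearW => N; apply/andP; split.
    rewrite -(ler_pM2l (ltr0Sn R N)) mulVKf ?pnatr_eq0//.
    by rewrite -[leLHS]expRK ler_ln ?posrE ?expR_gt0.
  rewrite -(ler_pM2l (ltr0Sn R N)) mulVKf ?pnatr_eq0//.
  rewrite mulrDr mulrCA mulfV ?pnatr_eq0// mulr1.
  rewrite -[X in _ <= X + _]expRK -lnM ?posrE ?expR_gt0 ?ltr0n//.
  by rewrite ler_ln ?posrE ?mulr_gt0 ?expR_gt0 ?ltr0n// mulrC.
- exact: cvg_cst.
- rewrite -[X in _ --> X]addr0; apply: cvgD; first exact: cvg_cst.
  rewrite -(mulr0 (ln n%:R)); apply: cvgM; first exact: cvg_cst.
  exact: cvg_harmonic.
Qed.

End mx_measurable.

(** * Integrable functions and equality of means *)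

Section means.
Local Open Scope ereal_scope.
Context d (T : measurableType d) (R : realType) (P : probability T R).
Implicit Types f g : T -> R.

Definition mean_fin f := P.-integrable setT (EFin \o f).

Lemma mean_finD f g : mean_fin f -> mean_fin g ->
  mean_fin (fun w => f w + g w)%R.
Proof. by move=> /integrableD h /h; exact. Qed.

Lemma mean_finB f g : mean_fin f -> mean_fin g ->
  mean_fin (fun w => f w - g w)%R.
Proof. by move=> /integrableB h /h; exact. Qed.

Lemma mean_finZ (k : R) f : mean_fin f -> mean_fin (fun w => k * f w)%R.
Proof. by move=> /(integrableZl measurableT k). Qed.

Lemma mean_fin_cst (k : R) : mean_fin (fun=> k).
Proof. exact: finite_measure_integrable_cst. Qed.

Lemma mean_fin_measurable f : mean_fin f -> measurable_fun setT f.
Proof. by move=> /measurable_int /measurable_EFinP. Qed.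

Lemma mean_fin_dominated f g : measurable_fun setT f -> mean_fin g ->
  {ae P, forall w, (`|f w| <= g w)%R} -> mean_fin f.
Proof.
move=> mf ig fg; apply/integrableP; split; first exact/measurable_EFinP.
have /integrableP[mg] := ig; apply: le_lt_trans.
apply: ae_ge0_le_integral => //.
  by apply: measurableT_comp => //; exact/measurable_EFinP.
  by apply: measurableT_comp => //; exact/measurable_EFinP.
apply: filterS fg => w fg _ /=; by rewrite lee_fin (le_trans fg)// ler_norm.
Qed.

Lemma le_mean_ae f g : mean_fin f -> mean_fin g ->
  {ae P, forall w, (f w <= g w)%R} ->
  \int[P]_w (f w)%:E <= \int[P]_w (g w)%:E.
Proof.
(* [h] lies above f everywhere and equals g almost everywhere. *)
move=> fi gi fg; pose h w := (f w + `|g w - f w|)%R.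
have hi : mean_fin h.
  apply: mean_finD => //.
  by have /integrable_norm := mean_finB gi fi.
apply: (@le_trans _ _ (\int[P]_w (h w)%:E)).
  by apply: le_integral => // w _; rewrite lee_fin lerDl.
rewrite le_eqVlt; apply/orP; left; apply/eqP; apply: ae_eq_integral => //.
- exact: measurable_int hi.
- exact: measurable_int gi.
- apply: filterS fg => w fg _; congr EFin.
  by rewrite /h ger0_norm ?subr_ge0// addrC subrK.
Qed.

(** Integrability is bundled in, so that the relation passes to linear combinations without side
    conditions. *)
Definition same_mean f g :=
  [/\ mean_fin f, mean_fin g & \int[P]_w (f w)%:E = \int[P]_w (g w)%:E].

Lemma same_mean_refl f : mean_fin f -> same_mean f f.
Proof. by []. Qed.

Lemma same_meanD f1 f2 g1 g2 : same_mean f1 g1 -> same_mean f2 g2 ->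
  same_mean (fun w => f1 w + f2 w)%R (fun w => g1 w + g2 w)%R.
Proof.
move=> [f1i g1i e1] [f2i g2i e2]; split; [exact: mean_finD|exact: mean_finD|].
have /= -> := @integralD _ _ _ P setT measurableT _ _ f1i f2i.
by have /= -> := @integralD _ _ _ P setT measurableT _ _ g1i g2i; rewrite e1 e2.
Qed.

Lemma same_meanZ (k : R) f g : same_mean f g ->
  same_mean (fun w => k * f w)%R (fun w => k * g w)%R.
Proof.
move=> [fi gi e]; split; [exact: mean_finZ|exact: mean_finZ|].
have /= -> := @integralZl _ _ _ P setT measurableT _ fi k.
by have /= -> := @integralZl _ _ _ P setT measurableT _ gi k; rewrite e.
Qed.

Lemma same_meanB f1 f2 g1 g2 : same_mean f1 g1 -> same_mean f2 g2 ->
  same_mean (fun w => f1 w - f2 w)%R (fun w => g1 w - g2 w)%R.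
Proof.
move=> h1 /(same_meanZ (-1)) h2; have := same_meanD h1 h2.
by under eq_fun do rewrite mulN1r; under [X in same_mean _ X]eq_fun do rewrite mulN1r.
Qed.

Lemma same_mean_sum (I : Type) (s : seq I) (F G : I -> T -> R) :
  (forall j, same_mean (F j) (G j)) ->
  same_mean (fun w => \sum_(j <- s) F j w)%R (fun w => \sum_(j <- s) G j w)%R.
Proof.
move=> FG; elim: s => [|j s IH].
  under eq_fun do rewrite big_nil; under [X in same_mean _ X]eq_fun do rewrite big_nil.
  by apply: same_mean_refl; exact: mean_fin_cst.
under eq_fun do rewrite big_cons; under [X in same_mean _ X]eq_fun do rewrite big_cons.
exact: same_meanD.
Qed.

Lemma same_mean_indep (u v : T -> R) : mean_fin u -> mean_fin v ->
  (forall A B, measurable A -> measurable B ->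
    P (u @^-1` A `&` v @^-1` B) = P (u @^-1` A) * P (v @^-1` B)) ->
  same_mean (fun w => v w * u w)%R
    (fun w => fine (\int[P]_w (v w)%:E) * u w)%R.
Proof.
move=> ui vi uv; have mu := mean_fin_measurable ui; have mv := mean_fin_measurable vi.
under eq_fun do rewrite mulrC; split.
- exact: (integrable_prod_indep mu mv).
- exact: mean_finZ.
- rewrite (integral_prod_indep mu mv)//.
  have /= -> := @integralZl _ _ _ P setT measurableT _ ui (fine (\int[P]_w (v w)%:E)).
  by rewrite fineK 1?muleC//; exact: integrable_fin_num.
Qed.

End means.

(** * Entries bounded by the trace *)

Section entry_bounds.
Variables (R : realType) (n : nat).
Implicit Types (U : 'M[R[i]]_n) (f : 'I_n -> R).

Lemma unitary_entry_le1 U i a : U \is unitarymx ->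
  complex.Re (U i a) ^+ 2 + complex.Im (U i a) ^+ 2 <= 1.
Proof.
move=> uU; have /matrixP/(_ i i) := unitarymxP uU; rewrite !mxE eqxx.
move=> /(congr1 (@complex.Re R)); rewrite cRe_sum /= => <-.
rewrite (bigD1 a)//= !mxE conjCE.
rewrite -[leLHS]addr0 lerD//.
  by case: (U i a) => x y /=; rewrite le_eqVlt; apply/orP; left; apply/eqP; ring.
apply: sumr_ge0 => b _; rewrite !mxE conjCE.
case: (U i b) => x y /=; rewrite (_ : _ - _ = x ^+ 2 + y ^+ 2); last by ring.
by rewrite addr_ge0 ?sqr_ge0.
Qed.

Lemma spectral_entry_bound U f a b : U \is unitarymx -> (forall i, 0 <= f i) ->
  `|complex.Re (spectral_mx U f a b)| <= \sum_i f i /\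
  `|complex.Im (spectral_mx U f a b)| <= \sum_i f i.
Proof.
move=> uU f0; rewrite spectral_mxE cRe_sum cIm_sum.
suff h i : `|complex.Re (Num.conj (U i a) * (f i)%:C * U i b)| <= f i /\
           `|complex.Im (Num.conj (U i a) * (f i)%:C * U i b)| <= f i.
  by split; apply: (le_trans (ler_norm_sum _ _ _)); apply: ler_sum => i _; have [] := h i.
have := unitary_entry_le1 i a uU; have := unitary_entry_le1 i b uU.
rewrite conjCE; case: (U i a) (U i b) => [x y] [z t] /= h1 h2.
have cauchy p q r s : p ^+ 2 + q ^+ 2 <= 1 -> r ^+ 2 + s ^+ 2 <= 1 ->
    `|p * r + q * s| <= 1 :> R.
  move=> hp hr; rewrite ler_norml.
  have := sqr_ge0 (p - r); have := sqr_ge0 (q - s).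
  have := sqr_ge0 (p + r); have := sqr_ge0 (q + s); lra.
split.
  rewrite [X in `|X|](_ : _ = f i * (x * z + y * t)); last by ring.
  by rewrite normrM ger0_norm// ler_piMr//; exact: cauchy.
rewrite [X in `|X|](_ : _ = f i * (x * t + (- y) * z)); last by ring.
rewrite normrM ger0_norm// ler_piMr//; apply: cauchy; rewrite ?sqrrN//.
by rewrite addrC.
Qed.

(** Makes the entries of a random exponential integrable as soon as its trace is. *)
Lemma expmx_entry_bound (A : 'M[R[i]]_n) a b :
  `|complex.Re (expmx A a b)| <= rtr (expmx A) /\
  `|complex.Im (expmx A a b)| <= rtr (expmx A).
Proof.
rewrite {2 4}/expmx rtr_spectral ?spectral_unitarymx//.
by apply: spectral_entry_bound; [exact: spectral_unitarymx|move=> i; exact: expR_ge0].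
Qed.

Lemma rtr_expmx_ge0 (A : 'M[R[i]]_n) : 0 <= rtr (expmx A).
Proof.
by rewrite rtr_spectral ?spectral_unitarymx//; apply: sumr_ge0 => i _; exact: expR_ge0.
Qed.

End entry_bounds.

(** * The trace of the exponential of a sum *)

Section trace_mgf.
Context d (T : measurableType d) (R : realType) (P : probability T R) (m n : nat).
Variables (X : 'I_m -> T -> 'M[R[i]]_n) (c : R).
Hypothesis hherm : forall i w, X i w \is hermsymmx.
Hypothesis hrand : forall i, random_matrix (X i).
Hypothesis hindep : independent_matrices P X.
Hypothesis c0 : 0 < c.
Hypothesis hbound : forall i, {ae P, forall w,
       [/\ 0 <= lambda n (X i w),
           lambda n (X i w) <= lambda 1 (X i w) &
           lambda 1 (X i w) <= c]}.

Lemma mx_measurable_X i : mx_measurable (X i).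
Proof.
move=> a b; split => _ B mB; rewrite setTI.
  by have := hrand i (mx_borel_Re a b mB).
by have := hrand i (mx_borel_Im a b mB).
Qed.

Lemma mx_measurable_cylinders (J : {set 'I_m}) i : i \in J ->
  @mx_measurable _ (g_sigma_algebraType (cylinders X J)) R n (X i).
Proof.
move=> iJ; have cyl (C : set 'M[R[i]]_n) : mx_borel C -> cylinders X J (X i @^-1` C).
  move=> mC; exists (fun j => if j == i then C else setT); split.
    by move=> j; case: ifP => // _; exact: mx_borelT.
  apply/seteqP; split=> [w Cw j jJ|w /(_ i iJ)/=]; last by rewrite eqxx.
  by rewrite /preimage/=; case: eqP => // ->.
move=> a b; split => _ B mB; rewrite setTI; apply: sub_sigma_algebra.
  exact/(cyl _ (mx_borel_Re a b mB)).
exact/(cyl _ (mx_borel_Im a b mB)).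
Qed.

Lemma eigval_ae i : {ae P, forall w j, 0 <= eigval (X i w) j <= c}.
Proof.
apply: filterS (hbound i) => w [h1 _ h2] j.
by have /andP[h3 h4] := eigval_bounds j (hherm i w); rewrite (le_trans h1)//= (le_trans h4).
Qed.

Lemma entry_ae i a b : {ae P, forall w, `|complex.Re (X i w a b)| <= c *+ n /\
  `|complex.Im (X i w a b)| <= c *+ n}.
Proof.
apply: filterS (eigval_ae i) => w ev.
have h0 j : 0 <= eigval (X i w) j by have /andP[] := ev j.
have := spectral_entry_bound a b (spectral_unitarymx (X i w)) h0.
rewrite -[spectral_mx _ _](funmx_id (hherm i w)) => -[h1 h2].
have h3 : \sum_j eigval (X i w) j <= c *+ n.
  rewrite -[n in leRHS]card_ord -sumr_const; apply: ler_sum => j _.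
  by have /andP[] := ev j.
by split; [exact: le_trans h1 h3|exact: le_trans h2 h3].
Qed.

Lemma mean_fin_Re i a b : mean_fin P (fun w => complex.Re (X i w a b)).
Proof.
apply: mean_fin_dominated (mean_fin_cst P (c *+ n)) _.
  by case: (mx_measurable_X i a b).
by apply: filterS (entry_ae i a b) => w [].
Qed.

Lemma mean_fin_Im i a b : mean_fin P (fun w => complex.Im (X i w a b)).
Proof.
apply: mean_fin_dominated (mean_fin_cst P (c *+ n)) _.
  by case: (mx_measurable_X i a b).
by apply: filterS (entry_ae i a b) => w [].
Qed.

Definition mean_mx i := expected_matrix P (X i).

Lemma mean_herm i : mean_mx i \is hermsymmx.
Proof.
apply/hermP/matrixP => a b; rewrite /mean_mx !mxE conjCE/=.
have E w : X i w a b = Num.conj (X i w b a).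
  by rewrite -{1}(hermP _ (hherm i w)) !mxE.
congr Complex.
  by congr fine; congr expectation; apply/funext => w; rewrite E conjCE.
rewrite -fineN; congr fine; rewrite !unlock.
rewrite -mulN1e -[(-1)%E]/((-1)%:E).
have /= <- := @integralZl _ _ _ P setT measurableT _ (mean_fin_Im i b a) (-1).
by apply: eq_integral => w _; rewrite E conjCE /= -EFinM mulN1r.
Qed.

Lemma meanE i a b : mean_mx i a b =
  fine (\int[P]_w (complex.Re (X i w a b))%:E) +i*
  fine (\int[P]_w (complex.Im (X i w a b))%:E).
Proof. by rewrite /mean_mx mxE !unlock. Qed.

Variable theta : R.
Let t := theta / c.
Let g := (expR theta - 1) / c.

Definition tilted (s : seq 'I_m) w : 'M[R[i]]_n :=
  \sum_(i <- s) (t%:C *: X i w - g%:C *: mean_mx i).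

Lemma tilted_herm s w : tilted s w \is hermsymmx.
Proof.
apply: herm_sum => i _; apply: hermD; first exact/hermZ/hherm.
exact/hermN/hermZ/mean_herm.
Qed.

(** Measurability for the cylinders over J, and not merely for T, is what makes the partial sum
    independent of a summand outside J. *)
Lemma tilted_measurable (s : seq 'I_m) (J : {set 'I_m}) (D : 'M[R[i]]_n) :
  {subset s <= J} ->
  @mx_measurable _ (g_sigma_algebraType (cylinders X J)) R n (fun w => D + tilted s w).
Proof.
move=> sJ; apply: mx_measurableD; first exact: mx_measurable_cst.
rewrite /tilted; elim: s sJ => [|i s IH] sJ.
  by under eq_fun do rewrite big_nil; exact: mx_measurable_cst.
under eq_fun do rewrite big_cons; apply: mx_measurableD; last first.
  by apply: IH => j js; apply: sJ; rewrite inE js orbT.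
apply: mx_measurableD; last exact: mx_measurable_cst.
by apply: mx_measurableZ; apply: mx_measurable_cylinders; apply: sJ; rewrite mem_head.
Qed.

Lemma sub_cylinders (J : {set 'I_m}) (f : T -> R) :
  measurable_fun (setT : set (g_sigma_algebraType (cylinders X J))) f ->
  measurable_fun (setT : set T) f.
Proof.
move=> mf _ B mB; have := mf measurableT B mB; rewrite !setTI.
apply: smallest_sub; first exact: sigma_algebra_measurable.
exact: cylinders_measurable.
Qed.

Lemma trace_exp_step i (B : 'M[R[i]]_n) w : B \is hermsymmx ->
  (forall j, 0 <= eigval (X i w) j <= c) ->
  rtr (expmx (B + t%:C *: X i w)) <=
  rtr (expmx B) + g * rtr (X i w *m expmx B).
Proof.
move=> hB ev; pose x j := c^-1 * eigval (X i w) j.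
have x01 j : 0 <= x j <= 1.
  have /andP[e0 ec] := ev j; rewrite /x mulr_ge0 ?invr_ge0 ?(ltW c0)//=.
  by rewrite mulrC ler_pdivrMr// mul1r.
have := rtr_expmx_shift theta (spectral_unitarymx (X i w)) x01 hB.
rewrite /x -spectral_mxZ -[spectral_mx _ _](funmx_id (hherm i w)).
rewrite scalerA -rmorphM -scalemxAl rtrZ mulrA.
by rewrite -/(theta / c) -/((expR theta - 1) / c).
Qed.

(** The trace is a signed sum of products of a real coordinate of X i with one of E. The latter is
    measurable for the cylinders over J, hence independent of the former because i is outside J. *)
Lemma same_mean_rtr i (J : {set 'I_m}) (E : T -> 'M[R[i]]_n) : i \notin J ->
  @mx_measurable _ (g_sigma_algebraType (cylinders X J)) R n E ->
  (forall a b, mean_fin P (fun w => complex.Re (E w a b))) ->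
  (forall a b, mean_fin P (fun w => complex.Im (E w a b))) ->
  same_mean P (fun w => rtr (X i w *m E w)) (fun w => rtr (mean_mx i *m E w)).
Proof.
move=> iJ mE rE iE; rewrite /rtr /mxtrace.
under eq_fun do rewrite cRe_sum; under [X in same_mean _ _ X]eq_fun do rewrite cRe_sum.
apply: same_mean_sum => a.
under eq_fun do rewrite mxE cRe_sum.
under [X in same_mean _ _ X]eq_fun do rewrite mxE cRe_sum.
apply: same_mean_sum => b.
under eq_fun do rewrite cReM; under [X in same_mean _ _ X]eq_fun do rewrite cReM meanE/=.
have pre (u : T -> R) A :
    measurable_fun (setT : set (g_sigma_algebraType (cylinders X J))) u -> measurable A -> <<s cylinders X J >> (u @^-1` A).
  by move=> mu mA; have := mu measurableT A mA; rewrite setTI.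
have [mr mi] := mE b a.
apply: same_meanB; apply: same_mean_indep => //;
  [exact: mean_fin_Re| |exact: mean_fin_Im|] => A B mA mB.
  exact: (indep_cylinders hrand hindep iJ (pre _ _ mr mA) (mx_borel_Re a b mB)).
exact: (indep_cylinders hrand hindep iJ (pre _ _ mi mA) (mx_borel_Im a b mB)).
Qed.

(* The free matrix D makes the induction work: the removed mean goes into it. *)
Lemma trace_mgf s : uniq s -> forall D : 'M[R[i]]_n, D \is hermsymmx ->
  mean_fin P (fun w => rtr (expmx (D + tilted s w))) /\
  (\int[P]_w (rtr (expmx (D + tilted s w)))%:E <= (rtr (expmx D))%:E)%E.
Proof.
elim: s => [_ D hD|i s IH /= /andP[is_ us] D hD].
  rewrite /tilted; under eq_fun do rewrite big_nil addr0; split.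
    exact: mean_fin_cst.
  under eq_integral do rewrite big_nil addr0.
  rewrite integral_cst//. by rewrite [X in (_ * X)%E](@probability_setT _ _ _ P) mule1.
pose D' := D - g%:C *: mean_mx i.
have hD' : D' \is hermsymmx := hermD hD (hermN (hermZ g (mean_herm i))).
pose B w := D' + tilted s w.
have hB w : B w \is hermsymmx := hermD hD' (tilted_herm s w).
have BE w : D + tilted (i :: s) w = B w + t%:C *: X i w.
  by rewrite /B /D' /tilted big_cons -!addrA; congr (_ + _); rewrite [LHS]addrC -addrA.
have KE w : D + tilted s w = B w + g%:C *: mean_mx i.
  by rewrite /B /D' -!addrA; congr (_ + _); rewrite [RHS]addrCA addNr addr0.
(* The induction hypothesis at D' serves only for the integrability of Tr exp B; the final bound
   uses it at D, to which Klein's inequality returns through [KE]. *)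
have [iB _] := IH us D' hD'; have [iK leK] := IH us D hD.
pose J := [set j in s]; have sJ : {subset s <= J} by move=> j; rewrite inE.
have iJ : i \notin J by rewrite inE.
have mE : @mx_measurable _ (g_sigma_algebraType (cylinders X J)) R n (fun w => expmx (B w)).
  by apply: mx_measurable_expmx => //; exact: tilted_measurable.
have rE a b : mean_fin P (fun w => complex.Re (expmx (B w) a b)).
  apply: mean_fin_dominated iB _.
    by have [+ _] := mE a b; exact: sub_cylinders.
  by apply: aeW => w; have [] := expmx_entry_bound (B w) a b.
have iE a b : mean_fin P (fun w => complex.Im (expmx (B w) a b)).
  apply: mean_fin_dominated iB _.
    by have [_] := mE a b; exact: sub_cylinders.
  by apply: aeW => w; have [] := expmx_entry_bound (B w) a b.
have [f1 f2 f12] :=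
  same_meanD (same_mean_refl iB) (same_meanZ g (same_mean_rtr iJ mE rE iE)).
have le1 : {ae P, forall w, rtr (expmx (D + tilted (i :: s) w)) <=
    rtr (expmx (B w)) + g * rtr (X i w *m expmx (B w))}.
  by apply: filterS (eigval_ae i) => w ev; rewrite BE; exact: (trace_exp_step (hB w) ev).
have i1 : mean_fin P (fun w => rtr (expmx (D + tilted (i :: s) w))).
  apply: mean_fin_dominated f1 _.
    apply: (@sub_cylinders [set j in i :: s]); apply: measurable_rtr.
    apply: mx_measurable_expmx => [w|]; first exact/(hermD hD)/tilted_herm.
    have sub : {subset i :: s <= [set j in i :: s]} by move=> j js; rewrite inE.
    exact: (tilted_measurable D sub).
  by apply: filterS le1 => w; rewrite (ger0_norm (rtr_expmx_ge0 _)).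
split; first exact: i1.
apply: le_trans leK; apply: (le_trans (le_mean_ae i1 f1 le1)).
rewrite f12; apply: (le_mean_ae f2 iK); apply: aeW => w; rewrite KE.
have := klein (hermD (hB w) (hermZ g (mean_herm i))) (hB w).
by rewrite [_ + _ - _]addrC addKr -scalemxAl rtrZ.
Qed.

End trace_mgf.

(** * Expectation and tail bounds *)

(** This is (n/k)^k <= C(n, k) without division. Since (k+1) C(n+1, k+1) = (n+1) C(n, k), the step
    asks for (n+1)^k <= (k+1)^k C(n, k), which follows from the case (n, k) and k (n+1) <= (k+1)
    n. *)
Lemma expn_le_binomial n k : (0 < k <= n)%N -> (n ^ k <= k ^ k * 'C(n, k))%N.
Proof.
elim: k n => [//|k IH] [//|n] /= kn; have {}kn : (k <= n)%N by [].
rewrite !expnS -mulnA [(k.+1 * _)%N]mulnCA -mul_bin_diag/= mulnCA leq_mul2l /=.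
have [->|k0] := posnP k; first by rewrite !expn0 bin0.
have kk0 : (0 < k ^ k)%N by rewrite expn_gt0 k0.
rewrite -(leq_pmul2l kk0) -expnMn.
apply: (@leq_trans ((k.+1 * n) ^ k)); first by rewrite leq_exp2r//; lia.
by rewrite expnMn mulnCA leq_mul2l IH ?orbT// k0 kn.
Qed.

Section binomial_root.
Variable R : realType.

Lemma ln_binomial n k : (0 < k <= n)%N ->
  k%:R * ln (n%:R / k%:R) <= ln ('C(n, k)%:R) :> R.
Proof.
move=> kn; have := expn_le_binomial kn; case/andP: kn => k0 kn h.
have n0 : (0 < n)%N by exact: leq_trans kn.
have q0 : 0 < n%:R / k%:R :> R by rewrite divr_gt0 ?ltr0n.
rewrite mulr_natl -lnXn// ler_ln ?posrE ?exprn_gt0 ?ltr0n ?bin_gt0//.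
rewrite expr_div_n ler_pdivrMr ?exprn_gt0 ?ltr0n//.
by rewrite -!natrX -natrM ler_nat mulnC.
Qed.

Lemma binomial_root n k : (0 < k <= n)%N ->
  n%:R / k%:R <= 'C(n, k)%:R `^ (1 / k%:R) :> R.
Proof.
move=> kn; have := ln_binomial kn; case/andP: kn => k0 kn h.
have n0 : (0 < n)%N by exact: leq_trans kn.
have q0 : 0 < n%:R / k%:R :> R by rewrite divr_gt0 ?ltr0n.
rewrite -ler_ln ?posrE ?powR_gt0 ?ltr0n ?bin_gt0// ln_powR.
have k0' : 0 < k%:R :> R by rewrite ltr0n.
by rewrite mul1r -(ler_pM2l k0') mulVKf ?gt_eqF.
Qed.

End binomial_root.

(** * From an exponential moment to a mean and a tail *)

Section exponential_moments.
Local Open Scope ereal_scope.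
Context d (T : measurableType d) (R : realType) (P : probability T R).
Variables (F : T -> R) (A : R).
Hypotheses (A0 : (0 < A)%R) (iE : mean_fin P (fun w => expR (F w))).
Hypothesis leA : \int[P]_w (expR (F w))%:E <= A%:E.

Lemma mean_le_ln : mean_fin P F -> \int[P]_w (F w)%:E <= (ln A)%:E.
Proof.
(* Jensen by the tangent of ln at A, evaluated at exp F: it lies above F and its mean is at most ln
   A. *)
move=> iF; pose G w := (A^-1 * expR (F w) + (ln A - 1))%R.
have iG1 := mean_finZ A^-1 iE; have iG2 := mean_fin_cst P (ln A - 1).
have iG : mean_fin P G := mean_finD iG1 iG2.
apply: (@le_trans _ _ (\int[P]_w (G w)%:E)).
  apply: le_mean_ae => //; apply: aeW => w; rewrite /G.
  have := expR_ge1Dx (F w - ln A); rewrite expRB lnK ?posrE// mulrC; lra.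
have /= -> := @integralD _ _ _ P setT measurableT _ _ iG1 iG2.
have /= -> := @integralZl _ _ _ P setT measurableT _ iE A^-1.
rewrite integral_cst// [X in _ + _ * X](@probability_setT _ _ _ P) mule1.
apply: (@le_trans _ _ (A^-1%:E * A%:E + (ln A - 1)%:E)).
  by rewrite leeD2r// lee_pmul2l// lte_fin invr_gt0.
by rewrite -EFinM mulVf ?gt_eqF// -EFinD lee_fin addrC subrK.
Qed.

(** Chernoff's argument: the indicator of S lies below exp(F - a). *)
Lemma tail_le (a : R) (S : set T) : measurable S ->
  (forall w, S w -> (a <= F w)%R) -> P S <= (A * expR (- a))%:E.
Proof.
move=> mS Sa; rewrite -(setIT S) -(integral_indic P measurableT)//.
have i1 : mean_fin P (\1_S)  by exact: integrable_indic.
have i2 := mean_finZ (expR (- a)) iE.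
apply: (@le_trans _ _ (\int[P]_w (expR (- a) * expR (F w))%:E)).
  apply: le_mean_ae => //; apply: aeW => w; rewrite indicE -expRD.
  have [/set_mem Sw|_] := boolP (w \in S); last exact: expR_ge0.
  by rewrite -[leLHS]expR0 ler_expR addrC subr_ge0 Sa.
have /= -> := @integralZl _ _ _ P setT measurableT _ iE (expR (- a)).
by rewrite mulrC EFinM lee_pmul2l// lte_fin expR_gt0.
Qed.

End exponential_moments.

Section top_sum_measurable.
Context d (T : measurableType d) (R : realType) (n k : nat) (F : T -> 'M[R[i]]_n).
Hypotheses (hF : forall w, F w \is hermsymmx) (mF : mx_measurable F).
Hypothesis kn : (k <= n)%N.

Lemma measurable_top_sum : measurable_fun setT (fun w => top_sum k (F w)).
Proof.
under eq_fun do rewrite /top_sum big_add1 big_mkord.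
apply: measurable_sum => j; apply: measurable_lambda => //=.
exact: leq_trans (ltn_ord j) kn.
Qed.

Lemma measurable_bot_sum : measurable_fun setT (fun w => bot_sum k (F w)).
Proof.
under eq_fun do rewrite /bot_sum big_add1 big_mkord.
apply: measurable_sum => j; apply: measurable_lambda => //=.
by have := ltn_ord j; lia.
Qed.

End top_sum_measurable.

Section bot_sum_ge0.
Variables (R : realType) (n k : nat).
Implicit Types A B : 'M[R[i]]_n.
Hypothesis kn : (0 < k <= n)%N.
Let kn' : (k <= n)%N. Proof. by case/andP: kn. Qed.

Lemma bot_sum_ge0 A : A \is hermsymmx -> 0 <= lambda n A -> 0 <= bot_sum k A.
Proof.
move=> hA l0; rewrite /bot_sum big_nat; apply: sumr_ge0 => j /andP[j0 jk].
by apply: (le_trans l0); apply: real_eigenvalues_geq => //; move: kn; lia.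
Qed.

(** Superadditivity of [bot_sum], which is [top_sumD] for the negated matrices. Through 0 <= bottom
    sum <= top sum it serves the integrability of both sums of Y. *)
Lemma bot_sum_sum_ge0 (I : Type) (s : seq I) (F : I -> 'M[R[i]]_n) :
  (forall j, F j \is hermsymmx) -> (forall j, 0 <= bot_sum k (F j)) ->
  0 <= bot_sum k (\sum_(j <- s) F j).
Proof.
move=> hF F0; elim: s => [|j s IH].
  have h0 := @herm0 R n; rewrite big_nil -oppr_le0 -top_sumN// oppr0.
  by rewrite -(scale0r (0 : 'M[R[i]]_n)) -(rmorph0 (real_complex R)) top_sumZ// mul0r.
have hs := herm_sum s (P := xpredT) (F := F) (fun j _ => hF j).
have := top_sumD (hermN (hF j)) (hermN hs) kn.
rewrite big_cons -opprD (top_sumN (hermD (hF j) hs) kn') (top_sumN (hF j) kn').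
rewrite (top_sumN hs kn') -opprD lerN2; apply: le_trans.
exact: (addr_ge0 (F0 j) IH).
Qed.

End bot_sum_ge0.

(** * Exponential moments of the extreme eigenvalue sums and their consequences *)

Section chernoff.
Context d (T : measurableType d) (R : realType) (P : probability T R) (m n : nat).
Variables (X : 'I_m -> T -> 'M[R[i]]_n) (c : R).
Hypothesis hherm : forall i w, X i w \is hermsymmx.
Hypothesis hrand : forall i, random_matrix (X i).
Hypothesis hindep : independent_matrices P X.
Hypothesis c0 : 0 < c.
Hypothesis hbound : forall i, {ae P, forall w,
       [/\ 0 <= lambda n (X i w),
           lambda n (X i w) <= lambda 1 (X i w) &
           lambda 1 (X i w) <= c]}.
Variable k : nat.
Hypothesis kn : (0 < k <= n)%N.

Let kn' : (k <= n)%N. Proof. by case/andP: kn. Qed.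
Let k0 : 0 < k%:R :> R. Proof. by case/andP: kn; rewrite ltr0n. Qed.
Let A0 (x : R) : 0 < n%:R / k%:R * expR x.
Proof.
rewrite mulr_gt0 ?expR_gt0// divr_gt0// ltr0n.
by case/andP: kn => ? /(leq_trans _); apply.
Qed.

Let Y w := \sum_(j < m) X j w.
Let EY := expected_matrix P Y.

Lemma sum_herm w : Y w \is hermsymmx.
Proof. by apply: herm_sum => i _; exact: hherm. Qed.

Lemma sum_measurable : mx_measurable Y.
Proof. by apply: mx_measurable_sum => i; exact: mx_measurable_X. Qed.

Lemma expected_sum : EY = \sum_(i < m) mean_mx P X i.
Proof.
apply/matrixP => a b; rewrite summxE [RHS]complexE [LHS]complexE.
rewrite cRe_sum cIm_sum /EY mxE /= expectation.unlock.
have lin (g : R[i] -> R) : {morph g : x y / x + y} -> g 0 = 0 ->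
    (forall i, mean_fin P (fun w => g (X i w a b))) ->
    fine (\int[P]_w (g (Y w a b))%:E) =
    \sum_(i < m) fine (\int[P]_w (g (X i w a b))%:E).
  move=> gD g0 ig.
  under eq_integral do rewrite /Y summxE (big_morph g gD g0) -sumEFin.
  rewrite (integral_sum measurableT (f := fun i w => (g (X i w a b))%:E))//.
  rewrite sum_fine// => i _; exact: (integrable_fin_num measurableT (ig i)).
have := lin _ (@cReD R) erefl (fun i => mean_fin_Re hherm hrand hbound i a b).
have := lin _ (@cImD R) erefl (fun i => mean_fin_Im hherm hrand hbound i a b).
move=> -> ->.
have -> : \sum_(i < m) complex.Re (mean_mx P X i a b) =
    \sum_(i < m) fine (\int[P]_w (complex.Re (X i w a b))%:E).
  by apply: eq_bigr => i _; rewrite meanE.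
have -> : \sum_(i < m) complex.Im (mean_mx P X i a b) =
    \sum_(i < m) fine (\int[P]_w (complex.Im (X i w a b))%:E).
  by apply: eq_bigr => i _; rewrite meanE.
by [].
Qed.

Lemma expected_sum_herm : EY \is hermsymmx.
Proof. by rewrite expected_sum; apply: herm_sum => i _; exact: mean_herm. Qed.

Lemma rtr_expmx0 : rtr (expmx (0 : 'M[R[i]]_n)) = n%:R.
Proof.
have u1 : (1%:M : 'M[R[i]]_n) \is unitarymx.
  by apply/unitarymxP; rewrite trmx1 map_mx1 mulmx1.
have -> : (0 : 'M[R[i]]_n) = spectral_mx 1%:M (fun=> 0).
  by apply/matrixP => a b; rewrite spectral_mxE mxE big1// => i _; rewrite mulr0 mul0r.
rewrite /expmx funmx_spectral// rtr_spectral//.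
under eq_bigr do rewrite /= expR0.
by rewrite sumr_const card_ord.
Qed.

Lemma centered_mgf (theta : R) :
  let Z w := (theta / c)%:C *: Y w - ((expR theta - 1) / c)%:C *: EY in
  mean_fin P (fun w => expR (top_sum k (Z w) / k%:R)) /\
  (\int[P]_w (expR (top_sum k (Z w) / k%:R))%:E <= (n%:R / k%:R)%:E)%E.
Proof.
move=> Z; have hZ w : Z w \is hermsymmx.
  exact: (hermD (hermZ _ (sum_herm w)) (hermN (hermZ _ expected_sum_herm))).
have mZ : mx_measurable Z.
  apply: mx_measurableD; last exact: mx_measurable_cst.
  by apply: mx_measurableZ; exact: sum_measurable.
have ZE w : Z w = 0 + tilted P X c theta (index_enum 'I_m) w.
  rewrite add0r /tilted sumrB -!scaler_sumr -expected_sum; congr (_ - _).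
have [iT leT] := trace_mgf hherm hrand hindep c0 hbound theta
  (index_enum_uniq 'I_m) (@herm0 R n).
have iT' := mean_finZ k%:R^-1 iT.
have le1 w : expR (top_sum k (Z w) / k%:R) <=
    k%:R^-1 * rtr (expmx (0 + tilted P X c theta (index_enum 'I_m) w)).
  rewrite -ZE -(ler_pM2l k0) mulVKf ?gt_eqF//.
  exact: (expR_top_sum (hZ w) kn).
have iE : mean_fin P (fun w => expR (top_sum k (Z w) / k%:R)).
  apply: mean_fin_dominated iT' _.
    apply: measurableT_comp => //; apply: measurable_funM; last exact: measurable_cst.
    exact: (measurable_top_sum hZ mZ kn').
  by apply: aeW => w; rewrite (ger0_norm (expR_ge0 _)).
split; first exact: iE.
apply: (le_trans (le_mean_ae iE iT' (aeW _ le1))).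
have /= -> := @integralZl _ _ _ P setT measurableT _ iT k%:R^-1.
rewrite mulrC EFinM lee_pmul2l// ?lte_fin ?invr_gt0//.
by rewrite -rtr_expmx0.
Qed.

Let mtop : measurable_fun setT (fun w => top_sum k (Y w)).
Proof. exact: (measurable_top_sum sum_herm sum_measurable kn'). Qed.
Let mbot : measurable_fun setT (fun w => bot_sum k (Y w)).
Proof. exact: (measurable_bot_sum sum_herm sum_measurable kn'). Qed.

(** Common to both ends of the spectrum: x is the deterministic contribution of EY that
    subadditivity splits off. *)
Lemma centered_mgf_le (theta x : R) (F : T -> R) : measurable_fun setT F ->
  (forall w, F w <= (top_sum k ((theta / c)%:C *: Y w -
                        ((expR theta - 1) / c)%:C *: EY) + x) / k%:R) ->
  mean_fin P (fun w => expR (F w)) /\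
  (\int[P]_w (expR (F w))%:E <= (n%:R / k%:R * expR (x / k%:R))%:E)%E.
Proof.
move=> mF leF; have [iZ leZ] := centered_mgf theta.
have iZ' := mean_finZ (expR (x / k%:R)) iZ.
have le1 w : expR (F w) <= expR (x / k%:R) * expR (top_sum k ((theta / c)%:C *: Y w -
    ((expR theta - 1) / c)%:C *: EY) / k%:R).
  by rewrite -expRD ler_expR addrC -mulrDl.
have iF : mean_fin P (fun w => expR (F w)).
  apply: mean_fin_dominated iZ' _; first exact: measurableT_comp.
  by apply: aeW => w; rewrite (ger0_norm (expR_ge0 _)).
split; first exact: iF.
apply: (le_trans (le_mean_ae iF iZ' (aeW _ le1))).
have /= -> := @integralZl _ _ _ P setT measurableT _ iZ (expR (x / k%:R)).
by rewrite [n%:R / k%:R * _]mulrC EFinM lee_pmul2l// lte_fin expR_gt0.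
Qed.

Lemma top_mgf (theta : R) : 0 <= theta ->
  mean_fin P (fun w => expR (theta / (c * k%:R) * top_sum k (Y w))) /\
  (\int[P]_w (expR (theta / (c * k%:R) * top_sum k (Y w)))%:E <=
   (n%:R / k%:R * expR ((expR theta - 1) / c * top_sum k EY / k%:R))%:E)%E.
Proof.
move=> t0; apply: (@centered_mgf_le theta) => [|w].
  by apply: measurable_funM => //; exact: measurable_cst.
have tc : 0 <= theta / c by rewrite divr_ge0// ltW.
have gc : 0 <= (expR theta - 1) / c.
  by rewrite divr_ge0 ?(ltW c0)// subr_ge0 -expR0 ler_expR.
have -> : theta / (c * k%:R) * top_sum k (Y w) = theta / c * top_sum k (Y w) / k%:R.
  by field; rewrite !gt_eqF.
rewrite ler_pM2r ?invr_gt0// -!top_sumZ ?sum_herm ?expected_sum_herm//.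
have hg := hermZ ((expR theta - 1) / c) expected_sum_herm.
rewrite -[in leLHS](subrK (((expR theta - 1) / c)%:C *: EY) (_ *: Y w)).
exact: (top_sumD (hermD (hermZ _ (sum_herm w)) (hermN hg)) hg kn).
Qed.

Lemma bot_mgf (theta : R) : 0 <= theta ->
  mean_fin P (fun w => expR (- (theta / (c * k%:R)) * bot_sum k (Y w))) /\
  (\int[P]_w (expR (- (theta / (c * k%:R)) * bot_sum k (Y w)))%:E <=
   (n%:R / k%:R * expR ((expR (- theta) - 1) / c * bot_sum k EY / k%:R))%:E)%E.
Proof.
move=> t0; apply: (@centered_mgf_le (- theta)) => [|w].
  by apply: measurable_funM => //; exact: measurable_cst.
have tc : 0 <= theta / c by rewrite divr_ge0// ltW.
have gc : 0 <= (1 - expR (- theta)) / c.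
  by rewrite divr_ge0 ?(ltW c0)// subr_ge0 -expR0 ler_expR oppr_le0.
have -> : - (theta / (c * k%:R)) * bot_sum k (Y w) =
    theta / c * (- bot_sum k (Y w)) / k%:R by field; rewrite !gt_eqF.
(* At -theta both coefficients are nonpositive, so the two matrices are nonnegative multiples of -Y
   and -EY, whose top sums are minus the bottom sums. *)
have gE : (expR (- theta) - 1) / c * bot_sum k EY =
    (1 - expR (- theta)) / c * (- bot_sum k EY) by field; rewrite gt_eqF.
rewrite ler_pM2r ?invr_gt0// gE -!top_sumN ?sum_herm ?expected_sum_herm//.
rewrite -!top_sumZ ?hermN ?sum_herm ?expected_sum_herm//.
have -> : (theta / c)%:C *: - Y w = (- theta / c)%:C *: Y w.
  by rewrite mulNr rmorphN scaleNr scalerN.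
have -> : ((1 - expR (- theta)) / c)%:C *: - EY = ((expR (- theta) - 1) / c)%:C *: EY.
  by rewrite -[1 - _]opprB mulNr rmorphN scaleNr scalerN opprK.
have hg := hermZ ((expR (- theta) - 1) / c) expected_sum_herm.
rewrite -[in leLHS](subrK (((expR (- theta) - 1) / c)%:C *: EY) (_ *: Y w)).
exact: (top_sumD (hermD (hermZ _ (sum_herm w)) (hermN hg)) hg kn).
Qed.

Lemma bot_sum_ae_ge0 : {ae P, forall w, 0 <= bot_sum k (Y w)}.
Proof.
have h : {ae P, forall w (i : 'I_m), 0 <= lambda n (X i w)}.
  by apply: filter_forall => i; apply: filterS (hbound i) => w [].
apply: filterS h => w hw.
apply: (bot_sum_sum_ge0 kn) => j; first exact: hherm.
exact: (bot_sum_ge0 kn (hherm j w) (hw j)).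
Qed.

Lemma mean_fin_top : mean_fin P (fun w => top_sum k (Y w)).
Proof.
(* The moment at theta = 1 dominates: s <= c k exp(s / (c k)) for the top sum s, which is almost
   surely nonnegative. *)
have [iE _] := top_mgf ler01.
apply: mean_fin_dominated (mean_finZ (c * k%:R) iE) _ => //.
apply: filterS bot_sum_ae_ge0 => w b0.
have t0 : 0 <= top_sum k (Y w) by exact: (le_trans b0 (bot_le_top (sum_herm w) kn')).
have ck : 0 < c * k%:R by rewrite mulr_gt0.
rewrite ger0_norm// -ler_pdivrMl//; apply: le_trans (expR_ge1Dx _).
by rewrite mul1r lerDr.
Qed.

Lemma mean_fin_bot : mean_fin P (fun w => bot_sum k (Y w)).
Proof.
apply: mean_fin_dominated mean_fin_top _ => //.
apply: filterS bot_sum_ae_ge0 => w b0; rewrite (ger0_norm b0).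
exact: (bot_le_top (sum_herm w) kn').
Qed.

Lemma ln_bound (x : R) :
  ln (n%:R / k%:R * expR x) <= ln ('C(n, k)%:R) / k%:R + x.
Proof.
have nk : 0 < n%:R / k%:R :> R.
  by rewrite divr_gt0// ltr0n; case/andP: kn => ? /(leq_trans _); apply.
rewrite lnM ?posrE ?expR_gt0// expRK lerD2r ler_pdivlMr// mulrC.
exact: ln_binomial.
Qed.

Lemma mean_top_le (theta : R) : 0 < theta ->
  (\int[P]_w (top_sum k (Y w))%:E <=
   ((expR theta - 1) / theta * top_sum k EY + c / theta * ln ('C(n, k)%:R))%:E)%E.
Proof.
move=> t0; have [iE leE] := top_mgf (ltW t0).
have q0 : 0 < theta / (c * k%:R) by rewrite divr_gt0// mulr_gt0.
have iF := mean_finZ (theta / (c * k%:R)) mean_fin_top.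
have := mean_le_ln (A0 _) iE leE iF.
have /= -> := @integralZl _ _ _ P setT measurableT _ mean_fin_top (theta / (c * k%:R)).
have fE := integrable_fin_num measurableT mean_fin_top; rewrite /= in fE.
rewrite -(fineK fE) -EFinM !lee_fin => /le_trans/(_ (ln_bound _)) h.
rewrite -(ler_pM2l q0) (le_trans h)// le_eqVlt; apply/orP; left; apply/eqP.
by field; rewrite !gt_eqF.
Qed.

Lemma mean_bot_ge (theta : R) : 0 < theta ->
  (((1 - expR (- theta)) / theta * bot_sum k EY - c / theta * ln ('C(n, k)%:R))%:E
   <= \int[P]_w (bot_sum k (Y w))%:E)%E.
Proof.
move=> t0; have [iE leE] := bot_mgf (ltW t0).
have q0 : 0 < theta / (c * k%:R) by rewrite divr_gt0// mulr_gt0.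
have iF := mean_finZ (- (theta / (c * k%:R))) mean_fin_bot.
have := mean_le_ln (A0 _) iE leE iF.
have /= -> := @integralZl _ _ _ P setT measurableT _ mean_fin_bot (- (theta / (c * k%:R))).
have fE := integrable_fin_num measurableT mean_fin_bot; rewrite /= in fE.
rewrite -(fineK fE) -EFinM !lee_fin => /le_trans/(_ (ln_bound _)) h.
rewrite -(ler_pM2l q0) -lerN2 -mulNr (le_trans h)// le_eqVlt; apply/orP; left; apply/eqP.
by field; rewrite !gt_eqF.
Qed.

Lemma top_tail (eps : R) : 0 <= eps ->
  (P [set w | (top_sum k (Y w) >= (1 + eps) * top_sum k EY)%R] <=
   ('C(n, k)%:R `^ (1 / k%:R) *
    (expR eps / (1 + eps) `^ (1 + eps)) `^ (1 / (c * k%:R) * top_sum k EY))%R%:E)%E.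
Proof.
move=> e0; have e1 : 0 < 1 + eps by rewrite ltr_pwDl.
(* theta = ln(1 + eps) minimizes exp(theta) - 1 - (1 + eps) theta, the Chernoff exponent up to the
   factor [top_sum k EY] / (c k). *)
have t0 : 0 <= ln (1 + eps) by rewrite ln_ge0// lerDl.
have q0 : 0 <= ln (1 + eps) / (c * k%:R) by rewrite divr_ge0// ltW// mulr_gt0.
have [iE leE] := top_mgf t0; set S := [set w | _].
have mS : measurable S.
  rewrite -[S]setTI; exact: (measurable_fun_le measurableT (measurable_cst _) mtop).
have := tail_le iE leE mS (a := ln (1 + eps) / (c * k%:R) * ((1 + eps) * top_sum k EY)).
move=> /(_ (fun w Sw => ler_wpM2l q0 Sw)) /le_trans; apply.
rewrite lee_fin -[leLHS]mulrA -expRD ler_pM ?expR_ge0 ?divr_ge0//.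
- exact: binomial_root.
- have -> : expR eps / (1 + eps) `^ (1 + eps) = expR (eps - (1 + eps) * ln (1 + eps)).
    by rewrite expRB /powR gt_eqF.
  rewrite lnK ?posrE// -expRM ler_expR.
  rewrite le_eqVlt; apply/orP; left; apply/eqP.
  by field; rewrite !gt_eqF.
Qed.

Lemma bot_tail (eps : R) : 0 <= eps < 1 ->
  (P [set w | (bot_sum k (Y w) <= (1 - eps) * bot_sum k EY)%R] <=
   ('C(n, k)%:R `^ (1 / k%:R) *
    (expR (- eps) / (1 - eps) `^ (1 - eps)) `^ (1 / (c * k%:R) * bot_sum k EY))%R%:E)%E.
Proof.
move=> /andP[e0 elt1]; have e1 : 0 < 1 - eps by rewrite subr_gt0.
(* theta = -ln(1 - eps) minimizes exp(-theta) - 1 + (1 - eps) theta; it is finite because eps <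
   1. *)
have t0 : 0 <= - ln (1 - eps) by rewrite oppr_ge0 ln_le0// gerBl.
have q0 : 0 <= - ln (1 - eps) / (c * k%:R) by rewrite divr_ge0// ltW// mulr_gt0.
have [iE leE] := bot_mgf t0; set S := [set w | _].
have mS : measurable S.
  rewrite -[S]setTI; exact: (measurable_fun_le measurableT mbot (measurable_cst _)).
have := tail_le iE leE mS
  (a := - (- ln (1 - eps) / (c * k%:R)) * ((1 - eps) * bot_sum k EY)).
have Sa w : S w -> - (- ln (1 - eps) / (c * k%:R)) * ((1 - eps) * bot_sum k EY) <=
    - (- ln (1 - eps) / (c * k%:R)) * bot_sum k (Y w).
  by move=> Sw; apply: ler_wnM2l => //; rewrite oppr_le0.
move=> /(_ Sa) /le_trans; apply.
rewrite lee_fin -[leLHS]mulrA -expRD ler_pM ?expR_ge0 ?divr_ge0//.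
- exact: binomial_root.
- have -> : expR (- eps) / (1 - eps) `^ (1 - eps) =
      expR (- eps - (1 - eps) * ln (1 - eps)) by rewrite expRB /powR gt_eqF.
  rewrite [- - ln _]opprK lnK ?posrE// -expRM ler_expR.
  rewrite le_eqVlt; apply/orP; left; apply/eqP.
  by field; rewrite !gt_eqF.
Qed.

End chernoff.

(* Lets c > 0 be assumed in the expectation bounds, by replacing c by c + e. *)
Lemma le_perturbed (R : realType) (x a c theta L : R) : 0 < theta -> 0 <= L ->
  (forall e, 0 < e -> x <= a + (c + e) / theta * L) -> x <= a + c / theta * L.
Proof.
move=> t0 L0 h; apply/ler_addgt0Pr => e e0.
have L1 : 0 < L + 1 by lra.
have e'0 : 0 < e * theta / (L + 1) by rewrite divr_gt0// mulr_gt0.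
apply: (le_trans (h _ e'0)).
have -> : (c + e * theta / (L + 1)) / theta * L = c / theta * L + e * (L / (L + 1)).
  by field; rewrite !gt_eqF.
by rewrite addrA lerD2l ler_piMr ?(ltW e0)// ler_pdivrMr// mul1r lerDl.
Qed.

Theorem theorem5p2 (R : realType) (d : measure_display) (T : measurableType d)
    (P : probability T R) (m n : nat) (X : 'I_m -> T -> 'M[R[i]]_n) (c : R)
    (hherm : forall i w, X i w \is hermsymmx)
    (hrand : forall i, random_matrix (X i))
    (hindep : independent_matrices P X)
    (hc : 0 <= c)
    (hbound : forall i, {ae P, forall w,
       [/\ 0 <= lambda n (X i w),
           lambda n (X i w) <= lambda 1 (X i w) &
           lambda 1 (X i w) <= c]})
    (k : nat) (hk : (1 <= k <= n)%N) :
  let Y : T -> 'M[R[i]]_n := fun w => \sum_(j < m) X j w in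
  let EY : 'M[R[i]]_n := expected_matrix P Y in
  let upper : 'M[R[i]]_n -> R :=
    fun A => \sum_(1 <= j < k.+1) lambda j A in
  let lower : 'M[R[i]]_n -> R :=
    fun A => \sum_(1 <= j < k.+1) lambda (n - j + 1)%N A in
  [/\ ('E_P[fun w => upper (Y w)] <=
       ereal_inf [set ((expR theta - 1) / theta * upper EY
                       + c / theta * ln ('C(n, k)%:R))%R%:E
                 | theta in [set t : R | (0 < t)%R]])%E,
      (ereal_sup [set ((1 - expR (- theta)) / theta * lower EY
                       - c / theta * ln ('C(n, k)%:R))%R%:E
                 | theta in [set t : R | (0 < t)%R]]
       <= 'E_P[fun w => lower (Y w)])%E,
      0 < c -> forall eps : R, 0 <= eps ->
        (P [set w | (upper (Y w) >= (1 + eps) * upper EY)%R] <=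
         ('C(n, k)%:R `^ (1 / k%:R) *
          (expR eps / (1 + eps) `^ (1 + eps))
            `^ (1 / (c * k%:R) * upper EY))%R%:E)%E &
      0 < c -> forall eps : R, 0 <= eps < 1 ->
        (P [set w | (lower (Y w) <= (1 - eps) * lower EY)%R] <=
         ('C(n, k)%:R `^ (1 / k%:R) *
          (expR (- eps) / (1 - eps) `^ (1 - eps))
            `^ (1 / (c * k%:R) * lower EY))%R%:E)%E].
Proof.
move=> Y EY upper lower.
have b0 (e : R) : 0 < e -> 0 < c + e by move=> e0; rewrite ltr_wpDl.
have bnd (e : R) (e0 : 0 < e) i : {ae P, forall w,
    [/\ 0 <= lambda n (X i w), lambda n (X i w) <= lambda 1 (X i w) &
        lambda 1 (X i w) <= c + e]}.
  by apply: filterS (hbound i) => w [? ? h]; split => //; rewrite (le_trans h)// lerDl ltW.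
have L0 : 0 <= ln ('C(n, k)%:R) :> R.
  by rewrite ln_ge0// ler1n bin_gt0; case/andP: hk.
split.
- rewrite expectation.unlock; apply: le_ereal_inf_tmp => _ [theta /= t0 <-].
  (* Integrability is obtained from a positive bound; c may be 0, and c + 1 serves. *)
  have iY := mean_fin_top hherm hrand hindep (b0 1 ltr01) (bnd 1 ltr01) hk.
  have fY := integrable_fin_num measurableT iY; rewrite /= in fY.
  rewrite -(fineK fY) lee_fin; apply: le_perturbed => // e e0.
  rewrite -lee_fin (fineK fY).
  exact: (mean_top_le hherm hrand hindep (b0 e e0) (bnd e e0) hk t0).
- rewrite expectation.unlock; apply: ge_ereal_sup => _ [theta /= t0 <-].
  have iY := mean_fin_bot hherm hrand hindep (b0 1 ltr01) (bnd 1 ltr01) hk.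
  have fY := integrable_fin_num measurableT iY; rewrite /= in fY.
  rewrite -(fineK fY) lee_fin lerBlDr; apply: le_perturbed => // e e0.
  rewrite -lerBlDr -lee_fin (fineK fY).
  exact: (mean_bot_ge hherm hrand hindep (b0 e e0) (bnd e e0) hk t0).
- by move=> c0 eps e0; exact: (top_tail hherm hrand hindep c0 hbound hk e0).
- by move=> c0 eps e0; exact: (bot_tail hherm hrand hindep c0 hbound hk e0).
Qed.
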